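(* Let $d\ge2$ be a fixed integer and let $(G_n)$ be a sequence of finite abelian groups of odd orders $N_n\to\infty$. Let $$Q_n^*=\inf\{q:\operatorname{diam}\Gamma_{G_n}(q)\le d\}.$$ Then $$\frac{2^d}{d!}N_n^{d-1}(Q_n^* )^d-\log N_n\xrightarrow{d}G_{\mathrm{Gum}}-\log 2,$$ where $G_{\mathrm{Gum}}$ has distribution function $\mathbb P(G_{\mathrm{Gum}}\le c)=\exp\{-e^{-c}\}$. If $c\in\mathbb R$ is fixed and $q_n\in[0,1]$ satisfies $$\frac{2^d}{d!}N_n^{d-1}q_n^d=\log N_n+c+o(1),$$ then, writing $V_n^{(q)}$ for the number of antipodal defect classes in $\Gamma_{G_n}(q_n)$, $$d_{\mathrm{TV}}\bigl(\mathcal L(V_n^{(q)}),\operatorname{Poisson}(e^{-c}/2)\bigr)\longrightarrow0$$ and $$\mathbb P\bigl(\operatorname{diam}\Gamma_{G_n}(q_n)\le d\bigr)\longrightarrow\exp\{-e^{-c}/2\}.$$ In particular, $q^d\sim \frac{d!}{2^d}\frac{\log N}{N^{d-1}}$ is the sharp threshold for diameter at most $d$ (with $d$ fixed) throughout the class of finite abelian groups of odd order $N\to\infty$.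
   Context: For a finite abelian group $G$ (written additively) of odd order $N$ and $q\in[0,1]$, let $S(q)\subseteq G\setminus\{0\}$ contain each nonzero element independently with probability $q$, and let $\Gamma_G(q)=\operatorname{Cay}(G,S(q)\cup(-S(q)))$ be the corresponding undirected Cayley graph. For the definition of the hitting time $Q_n^*$, the graphs for different $q$ are coupled monotonically: let $(U_a)_{a\in G\setminus\{0\}}$ be independent uniform random variables on $[0,1]$ and put $S(q)=\{a:U_a\le q\}$. The diameter is the graph diameter (infinite if disconnected). An antipodal defect class in $\Gamma_{G}(q)$ is an inversion class $[x]=\{x,-x\}$, $x\in G\setminus\{0\}$, with $\operatorname{dist}_{\Gamma_G(q)}(0,x)>d$. $\mathcal L(V)$ denotes the law of $V$ and $d_{\mathrm{TV}}$ total variation distance. That the displayed value is the sharp threshold means: for every $\varepsilon>0$ and every sequence of finite abelian groups $G_n$ of odd orders $N_n\to\infty$, the probability that $\operatorname{diam}\Gamma_{G_n}(q_n)\le d$ tends to $1$ if $q_n^d\ge(1+\varepsilon)\frac{d!}{2^d}\frac{\log N_n}{N_n^{d-1}}$ for all large $n$, and tends to $0$ if $q_n^d\le(1-\varepsilon)\frac{d!}{2^d}\frac{\log N_n}{N_n^{d-1}}$ for all large $n$. *)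

(* Defs.v *)
From HB Require Import structures.
From mathcomp Require Import all_boot all_order all_algebra.
From mathcomp Require Import all_classical all_reals all_analysis.

Set Implicit Arguments.
Unset Strict Implicit.
Unset Printing Implicit Defensive.

Import Order.TTheory GRing.Theory Num.Theory.
Import numFieldNormedType.Exports.

Local Open Scope classical_set_scope.
Local Open Scope ring_scope.

Section Graphs.
Variables (R : realType) (V : finType).

(* The infimum of the empty set is +oo: vertices in different components are
   at infinite distance, and disconnected graphs have infinite diameter. *)
Definition gdist (e : rel V) (x y : V) : \bar R :=
  ereal_inf [set (size p)%:R%:E | p in [set p : seq V | path e x p /\ last x p = y]].

Definition gdiam (e : rel V) : \bar R :=
  ereal_sup [set gdist e xy.1 xy.2 | xy in [set: V * V]].

End Graphs.
Arguments gdist R {V}.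
Arguments gdiam R {V}.

Definition cayley (G : finZmodType) (S : {set G}) : rel G :=
  [rel x y | y - x \in S].

Section Probability.
Variable R : realType.

Definition mutually_independent (disp : measure_display)
    (Omega : measurableType disp) (P : probability Omega R)
    (I : finType) (D : {set I}) (X : I -> {RV P >-> R}) : Prop :=
  forall (J : {set I}) (B : I -> set R), J \subset D ->
    (forall i, measurable (B i)) ->
    P (\bigcap_(i in [set` J]) (X i @^-1` B i)) =
    (\prod_(i in J) P (X i @^-1` B i))%E.

Definition dTV (disp : measure_display) (T : measurableType disp)
    (mu nu : set T -> \bar R) : \bar R :=
  ereal_sup [set `|mu A - nu A|%E | A in measurable].

(* The variables X n may live on different probability spaces. *)
Definition cvg_in_distribution (disp : nat -> measure_display)
    (Omega : forall n, measurableType (disp n))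
    (P : forall n, probability (Omega n) R) (X : forall n, Omega n -> R)
    (disp' : measure_display) (Omega' : measurableType disp')
    (P' : probability Omega' R) (Y : Omega' -> R) : Prop :=
  let F (c : R) := P' [set w | Y w <= c] in
  forall c : R, {for c, continuous F} ->
    P n [set w | X n w <= c] @[n --> \oo] --> F c.

End Probability.

(* The label of 0 is never used, so nothing is assumed about it. *)
Record labelling (R : realType) (G : finZmodType) := Labelling {
  label_disp : measure_display;
  label_space : measurableType label_disp;
  label_prob : probability label_space R;
  label : G -> {RV label_prob >-> R};
  label_uniform : forall (a : G) (B : set R), a != 0 -> measurable B ->
    distribution label_prob (label a) B = uniform_prob (@ltr01 R) B;
  label_independent : mutually_independent [set~ 0]%SET label
}.

Section RandomCayley.
Variables (R : realType) (G : finZmodType) (M : labelling R G).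
Implicit Types (d : nat) (q : R) (w : label_space M).

Definition random_set q w : {set G} :=
  finset (fun a : G => (a != 0) && (label M a w <= q)).

Definition Gamma q w : rel G :=
  cayley (random_set q w :|: [set - a | a in random_set q w])%SET.

Definition hitting_time d w : R :=
  inf [set q | 0 <= q <= 1 /\ (gdiam R (Gamma q w) <= d%:R%:E)%E].

Definition prob_diam_le d q : \bar R :=
  label_prob M [set w | (gdiam R (Gamma q w) <= d%:R%:E)%E].

Definition defect_classes d q w : {set {set G}} :=
  [set [set x; - x] | x in
    finset (fun x : G => (x != 0) && (d%:R%:E < gdist R (Gamma q w) 0%R x)%E)]%SET.

Definition num_defect_classes d q w : nat := #|defect_classes d q w|.

End RandomCayley.
Arguments hitting_time {R G} M d w.
Arguments num_defect_classes {R G} M d q w.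

Definition diam_sharp_threshold (R : realType) (d : nat) (thr : nat -> R) : Prop :=
  forall (eps : R) (G : nat -> finZmodType) (M : forall n, labelling R (G n))
    (q : nat -> R),
    0 < eps ->
    (forall n, odd #|G n|) ->
    #|G n| @[n --> \oo] --> \oo ->
    (forall n, 0 <= q n <= 1) ->
    ((\forall n \near \oo, (1 + eps) * thr #|G n| <= q n ^+ d) ->
       prob_diam_le (M n) d (q n) @[n --> \oo] --> 1%E) /\
    ((\forall n \near \oo, q n ^+ d <= (1 - eps) * thr #|G n|) ->
       prob_diam_le (M n) d (q n) @[n --> \oo] --> 0%E).

(* Main.v *)
(* A vertex x is a defect when no signed sum of at most d elements of the random
   set S equals x. Generic representations are d-subsets of letters (g, +-) with
   signed sum x; there are about 2^d N^(d-1) / d! of them, each present with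
   probability q^d, so their mean number is mu = log N + c + o(1). Harris'
   inequality bounds P(x is a defect) below by essentially exp(- mu), once the
   degenerate representations (fewer than d distinct elements) have been
   discarded on average over x; Janson's inequality gives the matching upper
   bounds exp(- mu) for one vertex and exp(- 2 mu) for two non-opposite vertices.
   Defects are decreasing events, hence positively associated, so the Stein-Chen
   method needs only these first and second moments to make the number of defect
   classes asymptotically Poisson(exp(- c) / 2), uniformly over all events. The
   diameter is at most d iff there is no defect, and monotonicity in q turns this
   into the law of the hitting time and the sharp threshold. *)
Require Import Defs.
From HB Require Import structures.
From mathcomp Require Import all_boot all_order all_algebra.
From mathcomp Require Import all_classical all_reals all_analysis.
From mathcomp Require Import ring lra zify.

Set Implicit Arguments.
Unset Strict Implicit.
Unset Printing Implicit Defensive.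

Import Order.TTheory GRing.Theory Num.Theory.
Import numFieldNormedType.Exports.

Local Open Scope ring_scope.

(** * Product Bernoulli measures, Harris and Janson inequalities *)

(** Throughout, [d = e.+2], N is the order of the group, M = 2N is the number of letters, L =
    M^(d-1) q^d, y = M q and mu = 2L/d!. Three obstacles shape the argument. Pairs of
    representations whose supports overlap partially cost O(L^2/y) in Janson's inequality, which is
    negligible since y^d = L M and L has the order of log N at criticality. Two sign patterns on one
    and the same support, however, have a union of only d elements and gain no factor q; such pairs
    are counted separately, and this is where division by 2 in the group is used. Degenerate
    representations can pile up on particular vertices, so there is no uniform lower bound vertex by
    vertex; hence the Poisson bound is arranged to ask only for a lower bound on the mean, next to
    upper bounds on single and pair probabilities. Finally, x and -x are defects together; keeping
    one vertex per inversion class removes these fully dependent pairs and produces the factor 1/2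
    in exp(- c) / 2. *)

Section Bernoulli.
Import mathcomp.boot.fintype mathcomp.boot.finset.
Variables (R : realType) (I : finType) (p : I -> R).
Implicit Types (S T : {set I}) (f g : {set I} -> R) (i : I).

Definition bernoulli_weight S : R := \prod_i (if i \in S then p i else 1 - p i).

Definition Ex f : R := \sum_S bernoulli_weight S * f S.

(** The conditional expectation of [f] given all coordinates except [i]. *)
Definition resample i f S : R := p i * f (i |: S)%SET + (1 - p i) * f (S :\ i)%SET.

Definition isotone f := forall S T, S \subset T -> f S <= f T.

Definition antitone f := forall S T, S \subset T -> f T <= f S.

Lemma eq_Ex f g : f =1 g -> Ex f = Ex g.
Proof. by move=> fg; apply: eq_bigr => S _; rewrite fg. Qed.

Lemma ExD f g : Ex (fun S => f S + g S) = Ex f + Ex g.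
Proof. by rewrite /Ex -big_split; apply: eq_bigr => S _; rewrite mulrDr. Qed.

Lemma ExZ a f : Ex (fun S => a * f S) = a * Ex f.
Proof. by rewrite /Ex mulr_sumr; apply: eq_bigr => S _; rewrite mulrCA. Qed.

Lemma ExN f : Ex (fun S => - f S) = - Ex f.
Proof. by rewrite /Ex -sumrN; apply: eq_bigr => S _; rewrite mulrN. Qed.

Lemma ExB f g : Ex (fun S => f S - g S) = Ex f - Ex g.
Proof. by rewrite ExD ExN. Qed.

Lemma Ex_sum (J : Type) (r : seq J) (P : pred J) (F : J -> {set I} -> R) :
  Ex (fun S => \sum_(j <- r | P j) F j S) = \sum_(j <- r | P j) Ex (F j).
Proof.
rewrite /Ex exchange_big /=.
by apply: eq_bigr => S _; rewrite mulr_sumr.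
Qed.

Lemma Ex_cst a : Ex (fun=> a) = a.
Proof.
rewrite /Ex -mulr_suml.
have -> : \sum_S bernoulli_weight S = \prod_i (p i + (1 - p i)).
  by rewrite bigA_distr.
by rewrite big1 ?mul1r// => i _; rewrite addrC subrK.
Qed.

Lemma sum_set_pair i (F : {set I} -> R) :
  \sum_S F S = \sum_(S : {set I} | i \notin S) (F S + F (i |: S)%SET).
Proof.
rewrite (bigID (fun S : {set I} => i \notin S)) big_split /=; congr (_ + _).
rewrite (reindex_onto (fun S : {set I} => i |: S)%SET (fun S => S :\ i)%SET) /=; last first.
  by move=> S; rewrite negbK => iS; rewrite setD1K.
apply: eq_bigl => S; rewrite setU11 /=.
apply/eqP/idP => [<-|iS]; first by rewrite setD11.
by rewrite setU1K.
Qed.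

Lemma Ex_resample i f : Ex (resample i f) = Ex f.
Proof.
rewrite /Ex !(sum_set_pair i); apply: eq_bigr => S iS.
pose w := \prod_(j | j != i) (if j \in S then p j else 1 - p j).
have -> : bernoulli_weight S = (1 - p i) * w.
  by rewrite /bernoulli_weight (bigD1 i)//= (negbTE iS).
have -> : bernoulli_weight (i |: S)%SET = p i * w.
  rewrite /bernoulli_weight (bigD1 i)//= setU11; congr (_ * _).
  by apply: eq_bigr => j ji; rewrite !inE (negbTE ji).
have iSE : (S :\ i = S)%SET by apply/setDidPl; rewrite disjoint_sym disjoints1.
by rewrite /resample setUA setUid setU1K// iSE; ring.
Qed.

Hypothesis p01 : forall i, 0 <= p i <= 1.

Let p_ge0 i : 0 <= p i. Proof. by have /andP[] := p01 i. Qed.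
Let p_le1 i : p i <= 1. Proof. by have /andP[] := p01 i. Qed.
Let q_ge0 i : 0 <= 1 - p i. Proof. by rewrite subr_ge0. Qed.

Lemma bernoulli_weight_ge0 S : 0 <= bernoulli_weight S.
Proof. by apply: prodr_ge0 => i _; case: ifP. Qed.

Lemma le_Ex f g : (forall S, f S <= g S) -> Ex f <= Ex g.
Proof.
by move=> fg; apply: ler_sum => S _; rewrite ler_wpM2l ?bernoulli_weight_ge0.
Qed.

Lemma Ex_ge0 f : (forall S, 0 <= f S) -> 0 <= Ex f.
Proof. by move=> f0; rewrite -(Ex_cst 0); exact: le_Ex. Qed.

Lemma norm_Ex f : `|Ex f| <= Ex (fun S => `|f S|).
Proof.
apply: le_trans (ler_norm_sum _ _ _) _; apply: ler_sum => S _.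
by rewrite normrM (ger0_norm (bernoulli_weight_ge0 S)).
Qed.

Lemma isotone_resample i f : isotone f -> isotone (resample i f).
Proof.
move=> mf S T ST; apply: lerD; rewrite ler_wpM2l//; apply: mf.
- exact: setUS.
- exact: setSD.
Qed.

(** Harris' inequality for a single coordinate: the gap is the covariance p (1 - p) (a - b) (a' -
    b') of two increasing functions of one Bernoulli variable. *)
Lemma resampleM_ge i f g S : isotone f -> isotone g ->
  resample i f S * resample i g S <= resample i (fun S => f S * g S) S.
Proof.
move=> mf mg; rewrite -subr_ge0 /resample.
have sub : (S :\ i \subset i |: S)%SET.
  by apply: subset_trans (subsetUr _ _); exact: subD1set.
have := mf _ _ sub; have := mg _ _ sub.
move: (f _) (f _) (g _) (g _) => a b a' b' h h'.
suff -> : p i * (a * a') + (1 - p i) * (b * b') -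
   (p i * a + (1 - p i) * b) * (p i * a' + (1 - p i) * b') =
   p i * (1 - p i) * ((a - b) * (a' - b')).
  by rewrite !mulr_ge0// subr_ge0.
by ring.
Qed.

(** Resampling the coordinates one at a time preserves monotonicity and, by the one-coordinate case,
    can only lower the expectation of the product. Once every coordinate has been resampled, both
    functions have become the constants [Ex f] and [Ex g]. *)
Lemma harris f g : isotone f -> isotone g -> Ex f * Ex g <= Ex (fun S => f S * g S).
Proof.
move=> mf mg.
pose it (s : seq I) h := foldr resample h s.
have itE s h : Ex (it s h) = Ex h by elim: s => //= i s <-; rewrite Ex_resample.
have mono s h : isotone h -> isotone (it s h).
  by move=> mh; elim: s => //= i s; exact: isotone_resample.
have step s : Ex (fun S => it s f S * it s g S) <= Ex (fun S => f S * g S).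
  elim: s => //= i s; apply: le_trans.
  rewrite -[leRHS](Ex_resample i); apply: le_Ex => S.
  by apply: resampleM_ge; exact: mono.
have itS s h S T : (forall i, i \notin s -> (i \in S) = (i \in T)) ->
    it s h S = it s h T.
  elim: s S T => [|i s IH] S T ST /=.
    by congr h; apply/setP => i; exact: ST.
  rewrite /resample; congr (_ * _ + _ * _); apply: IH => j js; rewrite !inE.
    by case: eqVneq => //= ji; apply: ST; rewrite inE negb_or ji.
  by case: eqVneq => //= ji; apply: ST; rewrite inE negb_or ji.
have cst h S : it (enum I) h S = Ex h.
  rewrite -(itE (enum I)) -[LHS]Ex_cst; apply: eq_Ex => T.
  by apply: itS => i; rewrite mem_enum.
rewrite -(Ex_cst (Ex f * Ex g)); apply: le_trans (step (enum I)).
by apply: le_Ex => S; rewrite !cst.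
Qed.

Lemma harris_antitone f g :
  antitone f -> antitone g -> Ex f * Ex g <= Ex (fun S => f S * g S).
Proof.
move=> mf mg.
have mN h : antitone h -> isotone (fun S => - h S) by move=> mh S T /mh; rewrite lerN2.
have := harris (mN _ mf) (mN _ mg).
rewrite !ExN mulrNN => /le_trans; apply; rewrite le_eqVlt; apply/orP; left.
by apply/eqP; apply: eq_Ex => S /=; rewrite mulrNN.
Qed.

Lemma harris_mixed f g :
  isotone f -> antitone g -> Ex (fun S => f S * g S) <= Ex f * Ex g.
Proof.
move=> mf mg.
have mN h : antitone h -> isotone (fun S => - h S) by move=> mh S T /mh; rewrite lerN2.
have := harris mf (mN _ mg).
rewrite ExN mulrN lerNl => /(le_trans _); apply.
by rewrite -ExN; apply: le_Ex => S /=; rewrite mulrN opprK.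
Qed.

Lemma antitone_prod (J : Type) (r : seq J) (F : J -> {set I} -> R) :
  (forall j S, 0 <= F j S) -> (forall j, antitone (F j)) ->
  antitone (fun S => \prod_(j <- r) F j S).
Proof.
move=> F0 mF S T ST; elim: r => [|j r IH]; first by rewrite !big_nil.
by rewrite !big_cons ler_pM// ?mF// prodr_ge0.
Qed.

Lemma harris_prod (J : Type) (r : seq J) (F : J -> {set I} -> R) :
  (forall j S, 0 <= F j S) -> (forall j, antitone (F j)) ->
  \prod_(j <- r) Ex (F j) <= Ex (fun S => \prod_(j <- r) F j S).
Proof.
move=> F0 mF; elim: r => [|j r IH].
  by rewrite big_nil; under eq_Ex do rewrite big_nil; rewrite Ex_cst.
rewrite big_cons [leRHS](_ : _ = Ex (fun S => F j S * \prod_(j <- r) F j S)); last first.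
  by apply: eq_Ex => S; rewrite big_cons.
have := harris_antitone (mF j) (@antitone_prod _ r _ F0 mF).
apply: le_trans.
by rewrite ler_wpM2l// Ex_ge0.
Qed.

Definition incl T S : R := (T \subset S)%:R.

Lemma incl_isotone T : isotone (incl T).
Proof.
move=> S S' SS'; rewrite ler_nat; case TS: (T \subset S) => //=.
by rewrite (subset_trans TS SS').
Qed.

Lemma incl_antitone T : antitone (fun S => 1 - incl T S).
Proof. by move=> S S' /(incl_isotone T) ?; rewrite lerB. Qed.

Lemma incl_ge0 T S : 0 <= incl T S. Proof. exact: ler0n. Qed.

Lemma incl_le1 T S : incl T S <= 1. Proof. by rewrite lern1 leq_b1. Qed.

(** The hypothesis says that [g] ignores the elements of [T], so that it is independent of the event
    that [S] contains [T]. Resampling one element of [T] extracts its factor [p i]. *)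
Lemma Ex_incl_indep T g : (forall i S, i \in T -> g (i |: S)%SET = g (S :\ i)%SET) ->
  Ex (fun S => incl T S * g S) = (\prod_(i in T) p i) * Ex g.
Proof.
move=> gT; have [n] := ubnP #|T|; elim: n T gT => // n IH T gT cT.
have [->|[i iT]] := set_0Vmem T.
  by rewrite big_set0 mul1r; apply: eq_Ex => S; rewrite /incl sub0set mul1r.
have step S : resample i (fun S => incl T S * g S) S = p i * (incl (T :\ i)%SET S * g S).
  have gS : g (S :\ i)%SET = g S.
    have [iS|iS] := boolP (i \in S); first by rewrite -gT// (setUidPr _) ?sub1set.
    by congr g; apply/setDidPl; rewrite disjoint_sym disjoints1.
  rewrite /resample gT// gS /incl subDset -[in X in _ + _ * X](setD1K iT).
  by rewrite subUset sub1set setD11 mul0r mulr0 addr0.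
rewrite -(Ex_resample i); under eq_Ex do rewrite step.
rewrite ExZ IH; last 2 first.
- by move=> j S /setD1P[_]; exact: gT.
- by move: cT; rewrite (cardsD1 i) iT.
by rewrite (big_setD1 i iT)/= mulrA.
Qed.

Lemma Ex_incl T : Ex (incl T) = \prod_(i in T) p i.
Proof.
have := @Ex_incl_indep T (fun=> 1) (fun _ _ _ => erefl).
by rewrite Ex_cst mulr1 => <-; apply: eq_Ex => S; rewrite mulr1.
Qed.

End Bernoulli.

Section Janson.
Import mathcomp.boot.fintype mathcomp.boot.finset.
Variables (R : realType) (I : finType) (p : I -> R).
Hypothesis p01 : forall i, 0 <= p i <= 1.
Implicit Types (S T : {set I}).

Definition incl_prob T : R := \prod_(i in T) p i.

Lemma incl_prob_ge0 T : 0 <= incl_prob T.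
Proof. by apply: prodr_ge0 => i _; have /andP[] := p01 i. Qed.

Lemma prod_1B_ge (J : Type) (r : seq J) (P : pred J) (x : J -> R) :
  (forall j, 0 <= x j <= 1) ->
  1 - \sum_(j <- r | P j) x j <= \prod_(j <- r | P j) (1 - x j).
Proof.
move=> x01; elim: r => [|j r IH]; first by rewrite !big_nil subr0.
rewrite !big_cons; case: ifP => // _.
have /andP[x0 x1] := x01 j.
have s0 : 0 <= \sum_(j <- r | P j) x j.
  by apply: sumr_ge0 => k _; have /andP[] := x01 k.
have y0 : 0 <= 1 - x j by rewrite subr_ge0.
apply: le_trans (ler_wpM2l y0 IH).
rewrite mulrBl mul1r opprD addrA -subr_ge0.
set a := \sum_(_ <- _ | _) _ in s0 *.
have -> : 1 - a - x j * (1 - a) - (1 - x j - a) = x j * a by ring.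
exact: mulr_ge0.
Qed.

Definition avoid (J : Type) (t : J -> {set I}) (s : seq J) S : R :=
  \prod_(b <- s) (1 - incl R (t b) S).

Let y0 T S : 0 <= 1 - incl R T S.
Proof. by rewrite subr_ge0 incl_le1. Qed.

Lemma avoid_ge0 (J : Type) (t : J -> {set I}) (s : seq J) S : 0 <= avoid t s S.
Proof. by apply: prodr_ge0. Qed.

Lemma avoidE (J : Type) (t : J -> {set I}) (s : seq J) S :
  avoid t s S = (all (fun a => ~~ (t a \subset S)) s)%:R.
Proof.
rewrite /avoid; elim: s => [|a s IH]; first by rewrite big_nil.
rewrite big_cons IH /incl /=; case: (t a \subset S); rewrite ?subrr ?mul0r//.
by rewrite subr0 mul1r.
Qed.

Lemma avoid_antitone (J : Type) (t : J -> {set I}) (s : seq J) :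
  antitone (avoid t s).
Proof. by apply: antitone_prod => // j; exact: incl_antitone. Qed.

Lemma inclU T1 T2 S : incl R (T1 :|: T2)%SET S = incl R T1 S * incl R T2 S.
Proof. by rewrite /incl subUset -natrM mulnb. Qed.

(* The sets disjoint from T are independent of the event that S contains T; the
   others are removed by a union bound, whose terms Harris controls. *)
Lemma janson_step (J : Type) (t : J -> {set I}) (s : seq J) T :
  Ex p (avoid t s) * (incl_prob T -
    \sum_(b <- s | ~~ [disjoint T & t b]) incl_prob (T :|: t b))
  <= Ex p (fun S => incl R T S * avoid t s S).
Proof.
set delta := (X in _ - X).
(* A negative factor makes the claim trivial; a nonnegative one allows [avoid t s] to be replaced on
   the left by the larger [avoid t s'], which is independent of the inclusion of [T]. *)
have [neg|pos] := ltP (incl_prob T - delta) 0.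
  apply: (@le_trans _ _ 0).
    by rewrite mulr_ge0_le0 ?(ltW neg)// Ex_ge0// => S; exact: avoid_ge0.
  by apply: Ex_ge0 => // S; rewrite mulr_ge0 ?incl_ge0 ?avoid_ge0.
pose s' := [seq b <- s | [disjoint T & t b]].
pose D S := \prod_(b <- s | ~~ [disjoint T & t b]) (1 - incl R (t b) S).
have NE S : avoid t s S = avoid t s' S * D S.
  by rewrite /avoid (bigID (fun b => [disjoint T & t b]))/= big_filter.
have D1 S : D S <= 1.
  rewrite /D; elim/big_rec: _ => // b x _ x1.
  rewrite -[leRHS]mul1r; apply: (le_trans (ler_wpM2l _ x1)) => //.
  by rewrite !mulr1 lerBlDr lerDl incl_ge0.
apply: (@le_trans _ _ (Ex p (avoid t s') * (incl_prob T - delta))).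
  rewrite ler_wpM2r//; apply: le_Ex => // S.
  by rewrite NE ler_piMr// avoid_ge0.
rewrite mulrBr mulrC -[incl_prob T]/(\prod_(i in T) p i) -(Ex_incl_indep p); last first.
  move=> i S iT; rewrite /avoid !big_filter; apply: eq_bigr => b Tb.
  have ib : i \notin t b.
    by apply/negP => ib; move/pred0P: Tb => /(_ i)/=; rewrite iT ib.
  congr (1 - _); rewrite /incl; congr (nat_of_bool _)%:R.
  by rewrite subsetD1 ib andbT -subDset (setDidPl _)// disjoint_sym disjoints1.
rewrite /delta mulr_sumr.
have step b : Ex p (fun S => incl R (T :|: t b) S * avoid t s' S) <=
    Ex p (avoid t s') * incl_prob (T :|: t b).
  rewrite mulrC /incl_prob -(Ex_incl p).
  by apply: harris_mixed => //; [exact: incl_isotone|exact: avoid_antitone].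
apply: le_trans (lerB (lexx _) (ler_sum _ (fun b _ => step b))) _.
rewrite -Ex_sum -ExB; apply: le_Ex => // S; rewrite NE.
rewrite (_ : \sum_(b <- s | _) _ =
    incl R T S * avoid t s' S * \sum_(b <- s | ~~ [disjoint T & t b]) incl R (t b) S).
  rewrite -[X in X - _]mulr1 -mulrBr mulrA ler_wpM2l//.
    by rewrite mulr_ge0 ?incl_ge0 ?avoid_ge0.
  by apply: prod_1B_ge => b; rewrite incl_ge0 incl_le1.
by rewrite mulr_sumr; apply: eq_bigr => b _; rewrite inclU mulrAC.
Qed.

(** Each index [a] multiplies the avoidance probability by at most 1 - P(a) + delta, where delta
    only involves the later indices; then 1 + x <= exp x. The induction meets each overlapping pair
    once while the statement counts ordered pairs, a loss of a factor 2 that does no harm. *)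
Lemma janson (J : eqType) (t : J -> {set I}) (s : seq J) : uniq s ->
  Ex p (avoid t s) <= expR (- \sum_(a <- s) incl_prob (t a) +
    \sum_(a <- s) \sum_(b <- s | (b != a) && ~~ [disjoint t a & t b])
       incl_prob (t a :|: t b)).
Proof.
elim: s => [_|a s IH /andP[as_ us]].
  rewrite !big_nil oppr0 addr0 expR0 -[leRHS](Ex_cst p); apply: le_Ex => // S.
  by rewrite /avoid big_nil.
set delta := \sum_(b <- s | ~~ [disjoint t a & t b]) incl_prob (t a :|: t b).
have -> : Ex p (avoid t (a :: s)) = Ex p (avoid t s) -
    Ex p (fun S => incl R (t a) S * avoid t s S).
  by rewrite -ExB; apply: eq_Ex => S; rewrite /avoid big_cons mulrBl mul1r.
have step := janson_step t s (t a).
apply: (@le_trans _ _ (Ex p (avoid t s) * (1 - incl_prob (t a) + delta))).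
  by rewrite -addrA mulrDr mulr1 lerD2l lerNl -mulrN opprD opprK.
apply: (@le_trans _ _ (Ex p (avoid t s) * expR (- incl_prob (t a) + delta))).
  rewrite ler_wpM2l//; first by apply: Ex_ge0 => // S; exact: avoid_ge0.
  by rewrite -addrA; exact: expR_ge1Dx.
apply: le_trans (ler_wpM2r (expR_ge0 _) (IH us)) _.
rewrite -expRD ler_expR.
rewrite !big_cons /= eqxx/=.
set X := \sum_(j <- s) incl_prob _; set Y := \sum_(i <- s) _.
set d' := \sum_(i <- s | _) _; set Y' := \sum_(i <- s) _.
have dE : delta = d'.
  rewrite /delta /d' big_seq_cond [RHS]big_seq_cond.
  apply: eq_bigl => b; case bs: (b \in s) => //=.
  by case: eqVneq => // ba; move: as_; rewrite -ba bs.
have YY' : Y <= Y'.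
  apply: ler_sum => b _; rewrite big_cons; case: ifP => // _.
  by rewrite lerDr incl_prob_ge0.
by rewrite dE; lra.
Qed.

End Janson.

(** * Poisson approximation *)

Section SteinChen.
Import mathcomp.boot.fintype mathcomp.boot.finset.
Variables (R : realType) (I : finType) (p : I -> R).
Hypothesis p01 : forall i, 0 <= p i <= 1.
Variables (J : finType) (D : {set J}) (X : J -> {set I} -> bool).
Hypothesis antiX : forall j (S T : {set I}), S \subset T -> X j T -> X j S.
Implicit Types (S T : {set I}).

Definition event_count S : nat := \sum_(j in D) X j S.

Definition event_prob j : R := Ex p (fun S => (X j S)%:R).

Definition event_prob2 i j : R := Ex p (fun S => (X i S)%:R * (X j S)%:R).

Let W' j S : nat := \sum_(i in D | i != j) X i S.

Let mean : R := \sum_(j in D) event_prob j.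

Let event_countE j S : j \in D -> event_count S = (X j S + W' j S)%N.
Proof. by move=> jD; rewrite /event_count (bigD1 j). Qed.

Let antiXR j : antitone (fun S => (X j S)%:R : R).
Proof. by move=> S T ST; rewrite ler_nat; have := @antiX j _ _ ST; case: (X j T) => // ->. Qed.

Let antiW' j (S T : {set I}) : S \subset T -> (W' j T <= W' j S)%N.
Proof.
by move=> ST; apply: leq_sum => i _; have := @antiX i _ _ ST; case: (X i T) => // ->.
Qed.

Let event_prob_ge0 j : 0 <= event_prob j.
Proof. by apply: Ex_ge0 => // S; rewrite ler0n. Qed.

Let Ex_W' j : Ex p (fun S => (W' j S)%:R) = \sum_(i in D | i != j) event_prob i.
Proof. by rewrite -Ex_sum; apply: eq_Ex => S; rewrite natr_sum. Qed.

Let norm_Ex_le (B : R) f : (forall S, `|f S| <= B) -> `|Ex p f| <= B.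
Proof.
by move=> fB; apply: le_trans (norm_Ex p01 _) _; rewrite -[leRHS](Ex_cst p); exact: le_Ex.
Qed.

Variables (g : nat -> R) (B : R).
Hypothesis gB : forall k, `|g k| <= B.

(* 2 B w + s g (w + 1) is nondecreasing in w when |s| <= 1 and |g| <= B, so Harris
   applies to it for s = 1 and s = -1; no monotone coupling is needed. *)
Let cov_le j : `|event_prob j * Ex p (fun S => g (W' j S).+1) -
    Ex p (fun S => (X j S)%:R * g (W' j S).+1)| <=
  2 * B * (Ex p (fun S => (X j S)%:R * (W' j S)%:R) -
           event_prob j * Ex p (fun S => (W' j S)%:R)).
Proof.
have B0 : 0 <= B := le_trans (normr_ge0 _) (gB 0).
have anti (s : R) : `|s| <= 1 ->
    antitone (fun S => 2 * B * (W' j S)%:R + s * g (W' j S).+1).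
  move=> s1 S T ST; have := antiW' j ST; rewrite leq_eqVlt => /orP[/eqP->//|].
  set a := W' j T; set b := W' j S => ab.
  have ga k : - B <= s * g k <= B.
    rewrite -ler_norml normrM -[leRHS]mul1r; exact: ler_pM.
  have /andP[ga1 ga2] := ga a.+1; have /andP[gb1 gb2] := ga b.+1.
  have : 2 * B * (a%:R + 1) <= 2 * B * b%:R.
    by rewrite ler_wpM2l ?mulr_ge0// natr1 ler_nat.
  by move: (a%:R : R) (b%:R : R) => x y; lra.
have main (s : R) : `|s| <= 1 ->
    s * (event_prob j * Ex p (fun S => g (W' j S).+1) -
    Ex p (fun S => (X j S)%:R * g (W' j S).+1)) <=
  2 * B * (Ex p (fun S => (X j S)%:R * (W' j S)%:R) -
           event_prob j * Ex p (fun S => (W' j S)%:R)).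
  move=> s1; have := harris_antitone p01 (antiXR j) (anti _ s1).
  rewrite ExD !ExZ (_ : Ex p (fun S => _ * (_ + _)) =
    2 * B * Ex p (fun S => (X j S)%:R * (W' j S)%:R) +
    s * Ex p (fun S => (X j S)%:R * g (W' j S).+1)); last first.
    by rewrite -!ExZ -ExD; apply: eq_Ex => S; ring.
  rewrite -/(event_prob j); lra.
rewrite ler_norml; apply/andP; split.
  by have := main (-1); rewrite normrN normr1 lexx mulN1r => /(_ isT); lra.
by have := main 1; rewrite normr1 lexx mul1r => /(_ isT).
Qed.

(** With W the count and W_j the count without j, the left side splits into (lam - mean) E g(W + 1),
    the terms P(j) E[g(W + 1) - g(W_j + 1)], and minus the covariances of X_j with g(W_j + 1). In
    the second kind W and W_j differ only when X_j occurs, which gives P(j)^2; Harris turns the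
    third kind into a covariance of X_j with W_j itself, where only pair probabilities remain. *)
Lemma stein_chen (lam : R) :
  `|Ex p (fun S => lam * g (event_count S).+1 -
        (event_count S)%:R * g (event_count S))| <=
  B * `|lam - mean| + 2 * B * (2 * \sum_(j in D) event_prob j ^+ 2 +
    \sum_(j in D) \sum_(i in D | i != j) event_prob2 j i - mean ^+ 2).
Proof.
have B0 : 0 <= B := le_trans (normr_ge0 _) (gB 0).
pose A1 := (lam - mean) * Ex p (fun S => g (event_count S).+1).
pose A2 j := event_prob j * (Ex p (fun S => g (event_count S).+1) -
   Ex p (fun S => g (W' j S).+1)).
pose A3 j := event_prob j * Ex p (fun S => g (W' j S).+1) -
    Ex p (fun S => (X j S)%:R * g (W' j S).+1).
rewrite (_ : Ex p _ = A1 + \sum_(j in D) (A2 j + A3 j)); last first.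
  rewrite ExB ExZ (_ : Ex p (fun S => _%:R * _) =
      \sum_(j in D) Ex p (fun S => (X j S)%:R * g (W' j S).+1)); last first.
    rewrite -Ex_sum; apply: eq_Ex => S; rewrite {1}/event_count natr_sum mulr_suml.
    apply: eq_bigr => j jD; rewrite (event_countE S jD).
    by case: (X j S); rewrite ?mul0r ?add1n.
  rewrite (_ : \sum_(j in D) (A2 j + A3 j) =
      \sum_(j in D) (event_prob j * Ex p (fun S => g (event_count S).+1) -
                     Ex p (fun S => (X j S)%:R * g (W' j S).+1))); last first.
    by apply: eq_bigr => j _; rewrite /A2 /A3 mulrBr addrA subrK.
  by rewrite sumrB -mulr_suml -/mean addrA -mulrDl subrK.
have A1B : `|A1| <= B * `|lam - mean|.
  by rewrite /A1 normrM mulrC ler_wpM2r// norm_Ex_le.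
have A2B j : j \in D -> `|A2 j| <= 2 * B * event_prob j ^+ 2.
  move=> jD; rewrite /A2 normrM (ger0_norm (event_prob_ge0 j)).
  rewrite expr2 mulrCA ler_wpM2l// -ExB.
  apply: le_trans (norm_Ex p01 _) _.
  rewrite /event_prob -ExZ; apply: le_Ex => // S.
  rewrite (event_countE S jD); case: (X j S); last by rewrite add0n subrr normr0 mulr0.
  by rewrite add1n mulr1 (le_trans (ler_normB _ _))// mulr2n mulrDl mul1r lerD.
apply: le_trans (ler_normD _ _) _; apply: lerD => //.
apply: le_trans (ler_norm_sum _ _ _) _.
apply: (@le_trans _ _ (\sum_(j in D) 2 * B * (event_prob j ^+ 2 +
  (Ex p (fun S => (X j S)%:R * (W' j S)%:R) - event_prob j * Ex p (fun S => (W' j S)%:R))))).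
  apply: ler_sum => j jD; rewrite mulrDr (le_trans (ler_normD _ _))// lerD ?A2B//.
  exact: cov_le.
rewrite -mulr_sumr ler_wpM2l ?mulr_ge0// le_eqVlt; apply/orP; left; apply/eqP.
have covE : \sum_(j in D) Ex p (fun S => (X j S)%:R * (W' j S)%:R) =
    \sum_(j in D) \sum_(i in D | i != j) event_prob2 j i.
  apply: eq_bigr => j jD; rewrite -Ex_sum; apply: eq_Ex => S.
  by rewrite natr_sum mulr_sumr.
(* W_j omits the term i = j, so each product falls short of P(j) times the mean by P(j)^2: this is
   the second copy of the squares in the bound. *)
have sqE : \sum_(j in D) event_prob j * Ex p (fun S => (W' j S)%:R) =
    mean ^+ 2 - \sum_(j in D) event_prob j ^+ 2.
  rewrite expr2 {1}/mean mulr_suml -sumrB.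
  apply: eq_bigr => j jD; rewrite Ex_W' /mean [in RHS](bigD1 j)//=.
  by ring.
by rewrite big_split/= sumrB covE sqE; ring.
Qed.

End SteinChen.

(** * The Stein equation for the Poisson law *)

Section SteinEquation.
Local Open Scope classical_set_scope.
Variable R : realType.
Implicit Types (lam x : R) (h : nat -> R).

Lemma series_exp_coeff_le lam n : 0 <= lam -> series (exp_coeff lam) n <= expR lam.
Proof.
move=> lam0; apply: nondecreasing_cvgn_le; last exact: is_cvg_series_exp_coeff.
by apply: nondecreasing_series => k _ _; exact: exp_coeff_ge0.
Qed.

Lemma leq_fact_mul m n : (m`! * n`! <= (m + n)`!)%N.
Proof.
have := bin_fact (leq_addr n m); rewrite addKn => <-.
by rewrite leq_pmull// bin_gt0 leq_addr.
Qed.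

(** The recursion is solved by partial sums of h(k) lam^k / k!. Since the whole series vanishes, a
    partial sum equals minus the remaining tail, and the tail after k is at most lam^(k+1) / k!
    times exp lam because k! i! <= (k + 1 + i)!. The bound [expR lam] is crude, but it does not
    depend on [h], and [lam] stays fixed in the limit. *)
Lemma stein_equation lam h : 0 < lam -> (forall k, `|h k| <= 1) ->
  series (fun k => h k * exp_coeff lam k) @ \oo --> 0 ->
  exists2 g : nat -> R, forall k, lam * g k.+1 - k%:R * g k = h k &
    forall k, `|g k| <= expR lam.
Proof.
move=> lam0 h1; set s := series _ => s0.
pose w := exp_coeff lam.
have wE k : w k = lam ^+ k / k`!%:R by rewrite /w exp_coeffE mulrC.
have f0 k : k`!%:R != 0 :> R by rewrite pnatr_eq0 -lt0n fact_gt0.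
have w0 k : 0 < w k by rewrite wE divr_gt0 ?exprn_gt0// ltr0n fact_gt0.
have wS k : k.+1%:R * w k.+1 = lam * w k.
  by rewrite !wE factS natrM exprS; field; rewrite f0/= addrC natr1 pnatr_eq0.
(* The value at 0 is a default: in the equation it only meets the factor k = 0. *)
exists (fun k => if k is k'.+1 then s k / (lam * w k') else 0) => [[|k]|[|k]].
- rewrite mul0r subr0 /s /series /= big_nat1 -/(w 0%N).
  move: (h 0%N) (w 0%N) (w0 0%N) => x y y0; field.
  by rewrite !gt_eqF.
- have -> : s k.+2 = s k.+1 + h k.+1 * w k.+1 by rewrite /s /series /= big_nat_recr.
  rewrite -(wS k); have := w0 k.+1; have : k.+1%:R != 0 :> R by rewrite pnatr_eq0.
  move: (k.+1%:R : R) (h k.+1) (w k.+1) (s k.+1) => c x y z c0 y0; field.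
  by rewrite c0 !gt_eqF.
- by rewrite normr0 expR_ge0.
have lw0 : 0 < lam * w k by exact: mulr_gt0.
rewrite normrM normfV (gtr0_norm lw0) ler_pdivrMr//.
have tail n : (k < n)%N -> `|s k.+1 - s n| <= expR lam * (lam * w k).
  move=> kn; rewrite distrC /s sub_series_geq//.
  apply: le_trans (ler_norm_sum _ _ _) _.
  apply: (@le_trans _ _ (\sum_(k.+1 <= j < n) lam * w k * w (j - k.+1)%N)).
    rewrite big_nat [leRHS]big_nat; apply: ler_sum => j /andP[kj _].
    rewrite normrM -[leRHS]mul1r ler_pM// -/(w j) (gtr0_norm (w0 _)).
    rewrite -{1}(subnKC kj); move: (j - k.+1)%N => i; rewrite !wE.
    have -> : lam * (lam ^+ k / k`!%:R) * (lam ^+ i / i`!%:R) =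
        lam ^+ (k.+1 + i) / (k`! * i`!)%:R.
      by rewrite exprD exprS natrM; field; rewrite !f0.
    rewrite ler_wpM2l ?exprn_ge0 ?(ltW lam0)//.
    rewrite lef_pV2 ?posrE ?ltr0n ?muln_gt0 ?fact_gt0// ler_nat.
    by apply: leq_trans (leq_fact_mul _ _) _; rewrite leq_fact// leq_add2r.
  rewrite -mulr_sumr mulrC; apply: ler_wpM2r (ltW lw0) _ _ _.
  rewrite -{1}(add0n k.+1) big_addn; under eq_bigr do rewrite addnK.
  exact: series_exp_coeff_le (ltW lam0).
have : `|s k.+1 - s n| @[n --> \oo] --> `|s k.+1 - 0|.
  by apply: cvg_norm; apply: cvgB => //; exact: cvg_cst.
rewrite subr0 => /cvgr_to_le; apply; near=> n; apply: tail.
by near: n; exact: nbhs_infty_gt.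
Unshelve. all: by end_near. Qed.

End SteinEquation.

(** The vanishing series makes [a] the Poisson probability of [A]. The Stein equation is solved for
    the indicator of [A] minus [a]; the resulting bound is free of [A], and so controls the total
    variation distance. *)
Lemma poisson_approximation (R : realType) (I : finType) (p : I -> R)
    (J : finType) (D : {set J}) (X : J -> {set I} -> bool) (lam a : R) (A : pred nat) :
  (forall i, 0 <= p i <= 1) ->
  (forall j (S T : {set I}), (S \subset T)%SET -> X j T -> X j S) ->
  0 < lam -> 0 <= a <= 1 ->
  (series (fun k => ((A k)%:R - a) * exp_coeff lam k) @ \oo --> 0)%classic ->
  `|Ex p (fun S => (A (event_count D X S))%:R) - a| <=
  expR lam * (`|lam - \sum_(j in D) event_prob p X j| +
    2 * (2 * \sum_(j in D) event_prob p X j ^+ 2 +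
     \sum_(j in D) \sum_(i in D | i != j) event_prob2 p X j i -
     (\sum_(j in D) event_prob p X j) ^+ 2)).
Proof.
move=> p01 antiX lam0 /andP[a0 a1] hcvg.
have [|g gE gB] := stein_equation lam0 _ hcvg.
  by move=> k; rewrite ler_norml; case: (A k) => /=; lra.
have := stein_chen p01 D antiX gB lam.
rewrite -(eq_Ex p (f := fun S => (A (event_count D X S))%:R - a)); last first.
  by move=> S; rewrite gE.
rewrite ExB Ex_cst => /le_trans; apply.
by rewrite [leRHS]mulrDr [in leRHS]mulrA [in leRHS](mulrC (expR lam) 2).
Qed.

(** * Signed subset sums in a group of odd order *)

Section SignedSums.
Import mathcomp.boot.fintype mathcomp.boot.finset.
Variable G : finZmodType.
Hypothesis oddG : odd #|G|.
Local Notation letter := (G * bool)%type.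
Implicit Types (u x : G) (h : letter) (T Y : {set letter}).

Definition letter_val h : G := if h.2 then - h.1 else h.1.

Definition signed_sum T : G := \sum_(h in T) letter_val h.

Definition sum_sets j u : {set {set letter}} :=
  [set T : {set letter} | (#|T| == j) && (signed_sum T == u)].

Lemma mulrn_card (u : G) : u *+ #|G| = 0.
Proof.
have : \sum_(x : G) x = \sum_(x : G) (x + u) by rewrite (reindex_inj (addIr u)).
rewrite big_split/= sumr_const => /eqP.
by rewrite -[eqbLHS]addr0 (inj_eq (addrI _)) => /eqP.
Qed.

(** In odd order N, multiplication by (N + 1)/2 inverts doubling. *)
Definition half u : G := u *+ #|G|.+1./2.

Lemma halfK u : half u *+ 2 = u.
Proof.
rewrite -mulrnA muln2 (_ : _.*2 = #|G|.+1) ?mulrS ?mulrn_card ?addr0//.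
by rewrite -[RHS]odd_double_half /= oddG.
Qed.

Lemma mulr2n_half u : half (u *+ 2) = u.
Proof. by rewrite /half mulrnAC -/(half u) halfK. Qed.

Lemma double_eq0 u : (u *+ 2 == 0) = (u == 0).
Proof.
apply/eqP/eqP => [u0|->]; last by rewrite mul0rn.
by rewrite -(mulr2n_half u) u0 /half mul0rn.
Qed.

Lemma card_letter : #|{: letter}| = (2 * #|G|)%N.
Proof. by rewrite card_prod card_bool mulnC. Qed.

Lemma card_letter_val u : #|[set h : letter | letter_val h == u]| = 2%N.
Proof.
have -> : [set h : letter | letter_val h == u] = [set (u, false); (- u, true)].
  apply/setP => -[g []]; rewrite !inE /letter_val /= !xpair_eqE /= ?andbT ?andbF ?orbF//=.
  by rewrite eqr_oppLR.
by rewrite cards2 xpair_eqE andbF.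
Qed.

Lemma signed_sumU1 h T : h \notin T -> signed_sum (h |: T) = letter_val h + signed_sum T.
Proof. by move=> hT; rewrite /signed_sum big_setU1. Qed.

(** Counts the pairs of a set and one of its letters in two ways, which yields a recursion in the
    size of the set. The condition that [h] is not in [Y] is the only deviation from an exact
    product formula. *)
Lemma sum_sets_double_count j u : (j.+1 * #|sum_sets j.+1 u| =
  \sum_(h : letter) #|[set Y in sum_sets j (u - letter_val h)%R | h \notin Y]|)%N.
Proof.
transitivity (\sum_(T in sum_sets j.+1 u) \sum_(h in T) 1)%N.
  rewrite mulnC -sum_nat_const; apply: eq_bigr => T.
  by rewrite inE sum1_card => /andP[/eqP->].
rewrite (exchange_big_dep predT)//=; apply: eq_bigr => h _.
rewrite sum1dep_card -[RHS](card_in_imset (f := fun Y => h |: Y)); last first.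
  move=> Y Y'; rewrite !inE => /andP[_ hY] /andP[_ hY'] YY'.
  by rewrite -(setU1K hY) YY' setU1K.
apply: eq_card => T; rewrite inE; apply/andP/imsetP => [|[Y]].
  rewrite inE => -[/andP[/eqP cT /eqP sT] hT].
  exists (T :\ h); last by rewrite setD1K.
  rewrite !inE eqxx andbT -eqSS -cT (cardsD1 h T) hT add1n eqxx/=.
  by rewrite -sT -{2}(setD1K hT) signed_sumU1 ?setD11// addrC addKr.
rewrite !inE => /andP[/andP[/eqP cY /eqP sY] hY] ->.
by rewrite setU11 cardsU1 hY cY add1n eqxx signed_sumU1// sY addrC subrK eqxx.
Qed.

Lemma card_sum_sets0 u : #|sum_sets 0 u| = (u == 0) :> nat.
Proof.
have -> : sum_sets 0 u = if u == 0 then [set set0] else set0.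
  apply/setP => T; rewrite inE cards_eq0; case: eqVneq => [->|T0] /=.
    by rewrite /signed_sum big_set0 eq_sym; case: ifP; rewrite !inE ?eqxx.
  by case: ifP; rewrite !inE // (negbTE T0).
by case: ifP; rewrite ?cards1 ?cards0.
Qed.

Lemma card_sum_sets1 u : #|sum_sets 1 u| = 2%N.
Proof.
rewrite -[LHS]mul1n sum_sets_double_count -(card_letter_val u) -sum1_card [RHS]big_mkcond/=.
apply: eq_bigr => h _; rewrite inE.
have -> : [set Y in sum_sets 0 (u - letter_val h) | h \notin Y] =
    sum_sets 0 (u - letter_val h).
  by apply/setP => Y; rewrite !inE cards_eq0; case: eqVneq => // ->; rewrite inE andbT.
by rewrite card_sum_sets0 subr_eq0 eq_sym; case: eqP.
Qed.

Local Notation M := (2 * #|G|)%N.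

(** Choosing j letters freely leaves the value of the last one prescribed; the factor 2 appears
    because every value is taken by exactly two letters, (u, +) and (-u, -). *)
Lemma card_sum_sets_le j u : (j.+1`! * #|sum_sets j.+1 u| <= 2 * M ^ j)%N.
Proof.
elim: j u => [|j IH] u; first by rewrite card_sum_sets1.
rewrite factS mulnAC sum_sets_double_count mulnC big_distrr/=.
apply: (@leq_trans (\sum_(h : letter) 2 * M ^ j)%N).
  apply: leq_sum => h _; apply: leq_trans (IH (u - letter_val h)).
  rewrite leq_pmul2l ?fact_gt0//.
  by apply: subset_leq_card; apply/subsetP => Y; rewrite inE => /andP[].
by rewrite sum_nat_const card_letter mulnCA expnS.
Qed.

Lemma card_sum_sets_mem j u h :
  (#|[set T in sum_sets j.+1 u | h \in T]| <= #|sum_sets j (u - letter_val h)%R|)%N.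
Proof.
rewrite -(card_in_imset (f := fun Y => Y :\ h)); last first.
  move=> Y Y'; rewrite !inE => /andP[_ hY] /andP[_ hY'] YY'.
  by rewrite -(setD1K hY) YY' setD1K.
apply: subset_leq_card; apply/subsetP => T /imsetP[Y].
rewrite !inE => /andP[/andP[/eqP cY /eqP sY] hY] ->.
have -> : #|Y :\ h| = j by apply/eqP; rewrite -eqSS -cY (cardsD1 h Y) hY.
move: sY; rewrite -{1}(setD1K hY) signed_sumU1 ?setD11// eqxx/= => sY.
by rewrite -sY addrC addKr.
Qed.

(** The error term of the recursion. Removing [h] from [Y] leaves a set of sum u - 2 h; when that
    set is empty, 2 h = u must be solved, and odd order leaves exactly two letters [h]. *)
Lemma sum_sets_repeat_le j u : (j.+1`! *
  \sum_(h : letter) #|[set Y in sum_sets j.+1 (u - letter_val h)%R | h \in Y]| <=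
  2 * j.+1 * M ^ j)%N.
Proof.
apply: (@leq_trans (j.+1`! * \sum_(h : letter) #|sum_sets j (u - letter_val h *+ 2)%R|)).
  rewrite leq_pmul2l ?fact_gt0//; apply: leq_sum => h _.
  apply: leq_trans (card_sum_sets_mem j (u - letter_val h) h) _.
  by rewrite mulr2n opprD addrA.
case: j => [|j].
  apply: (@leq_trans 2%N) => //; rewrite mul1n (eq_bigr (fun h => (letter_val h == half u) : nat)).
    by rewrite -(card_letter_val (half u)) -sum1_card -big_mkcond/=; apply/eq_leq/eq_bigl => h; rewrite inE.
  move=> h _; rewrite card_sum_sets0 subr_eq0; congr nat_of_bool.
  by rewrite -{1}(halfK u) -subr_eq0 -mulrnBl double_eq0 subr_eq0 eq_sym.
rewrite big_distrr/=; apply: (@leq_trans (\sum_(h : letter) j.+2 * (2 * M ^ j))%N).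
  apply: leq_sum => h _; rewrite factS -mulnA leq_pmul2l//; exact: card_sum_sets_le.
by rewrite sum_nat_const card_letter expnS; apply/eq_leq; ring.
Qed.

(** Each round of the recursion adds an error 2 (j + 1) M^j to the inherited j (j + 1) M^j, whence
    the coefficient (j + 1) (j + 2) at the next size. *)
Lemma card_sum_sets_ge j u :
  (2 * M ^ j <= j.+1`! * #|sum_sets j.+1 u| + j * j.+1 * M ^ j.-1)%N.
Proof.
elim: j u => [|j IH] u; first by rewrite card_sum_sets1.
have split h : #|sum_sets j.+1 (u - letter_val h)| =
    (#|[set Y in sum_sets j.+1 (u - letter_val h)%R | h \notin Y]| +
     #|[set Y in sum_sets j.+1 (u - letter_val h)%R | h \in Y]|)%N.
  rewrite addnC -[LHS](cardsID [set Y : {set letter} | h \in Y]).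
  by congr addn; apply: eq_card => Y; rewrite !inE // andbC.
rewrite factS mulnAC sum_sets_double_count.
have := sum_sets_repeat_le j u.
set bad := (\sum_h _)%N => badle.
have : (\sum_(h : letter) 2 * M ^ j <= \sum_(h : letter) (j.+1`! * #|sum_sets j.+1 (u - letter_val h)%R| +
   j * j.+1 * M ^ j.-1))%N by apply: leq_sum => h _; exact: IH.
rewrite [leqRHS]big_split/= !sum_nat_const card_letter.
have -> : (\sum_(h : letter) j.+1`! * #|sum_sets j.+1 (u - letter_val h)%R| =
    j.+1`! * (\sum_(h : letter) #|[set Y in sum_sets j.+1 (u - letter_val h)%R | h \notin Y]| + bad))%N.
  by rewrite -big_split/= big_distrr/=; apply: eq_bigr => h _; rewrite split.
set good := (\sum_h _)%N => H.
have H' : (M * (j * j.+1 * M ^ j.-1) <= j * j.+1 * M ^ j)%N.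
  case: j {IH split bad badle good H} => [|j]; first by rewrite !mul0n muln0.
  by rewrite /= expnS; apply/eq_leq; ring.
rewrite expnS; move: badle H H'; move: (M ^ j)%N (M ^ j.-1)%N (j.+1`!) => X Y f.
rewrite mulnDr => h1 h2 h3.
have h4 := leq_trans h2 (leq_add (leq_add (leqnn _) h1) h3).
rewrite (_ : 2 * _ = 2 * #|G| * (2 * X))%N; last by ring.
by apply: leq_trans h4 _; apply: eq_leq; ring.
Qed.

End SignedSums.

Lemma card_cover_le (T I : finType) (S : {set T}) (r : pred I) (F : I -> {set T}) :
  (forall s, s \in S -> exists2 i, r i & s \in F i) ->
  (#|S| <= \sum_(i | r i) #|F i|)%N.
Proof.
move=> cov; rewrite -sum1_card (eq_bigr (fun i => \sum_s (s \in F i : nat))%N); last first.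
  by move=> i _; rewrite -sum1_card big_mkcond.
rewrite exchange_big big_mkcond/=; apply: leq_sum => s _; case: ifP => // sS.
by have [i ri si] := cov s sS; rewrite (bigD1 i)//= si.
Qed.

(** * Generic signed sets *)

Section Families.
Import mathcomp.boot.fintype mathcomp.boot.finset.
Variable G : finZmodType.
Hypothesis oddG : odd #|G|.
Local Notation letter := (G * bool)%type.
Local Notation M := (2 * #|G|)%N.
Implicit Types (u x : G) (h : letter) (T Y : {set letter}) (Z : {set G}).

Definition proj T : {set G} := [set h.1 | h in T].

(** Distinct nonzero underlying elements: the event that all of them are chosen then has probability
    exactly q to the power [#|T|]. *)
Definition good T := (#|proj T| == #|T|) && (0 \notin proj T).

Definition family d Z : {set {set letter}} :=
  [set T : {set letter} | [&& #|T| == d, signed_sum T \in Z & good T]].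

Lemma good_inj T h h' : good T -> h \in T -> h' \in T -> h.1 = h'.1 -> h = h'.
Proof. by move=> /andP[/imset_injP inj _] hT h'T; exact: inj. Qed.

Lemma card_family_le e x : (e.+1`! * #|family e.+1 [set x]| <= 2 * M ^ e)%N.
Proof.
apply: leq_trans (card_sum_sets_le e x); rewrite leq_pmul2l ?fact_gt0//.
apply: subset_leq_card; apply/subsetP => T; by rewrite !inE => /and3P[-> ->].
Qed.

Lemma card_family_sum d Z : #|family d Z| = (\sum_(z in Z) #|family d [set z]|)%N.
Proof.
rewrite -sum1_card (partition_big (fun T => signed_sum T) (mem Z))/=; last first.
  by move=> T; rewrite inE => /and3P[].
apply: eq_bigr => z zZ; rewrite -sum1_card; apply: eq_bigl => T; rewrite !inE.
by case: (eqVneq (signed_sum T) z) => [->|]; rewrite ?zZ ?andbT ?andbF.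
Qed.

(** From all signed sets of sum x those containing a letter over 0, or both signs of some g, are
    discarded. A letter over 0 fixes one element of the set; a pair of opposite signs contributes 0
    to the sum and uses up two elements at the price of one free choice of g. Both classes are
    smaller than the main term by a factor of order M. *)
Lemma card_family_ge e x : x != 0 ->
  (2 * M ^ e.+1 <= e.+2`! * (#|family e.+2 [set x]| + 6 * M ^ e))%N.
Proof.
move=> x0; pose zero b := [set T in sum_sets e.+2 x | (0, b) \in T].
pose twin g := [set T in sum_sets e.+2 x | ((g, false) \in T) && ((g, true) \in T)].
have zeroE b T : (T \in zero b) = (T \in sum_sets e.+2 x) && ((0, b) \in T) by rewrite inE.
have twinE g T : (T \in twin g) = (T \in sum_sets e.+2 x) &&
   (((g, false) \in T) && ((g, true) \in T)) by rewrite inE.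
have cov : (#|sum_sets e.+2 x| <= #|family e.+2 [set x]| + (#|zero false| + #|zero true| +
    \sum_g #|twin g|))%N.
  have sub : sum_sets e.+2 x \subset
      family e.+2 [set x] :|: (zero false :|: zero true :|: \bigcup_g twin g).
    apply/subsetP => T TS; rewrite !in_setU.
    have -> : (T \in family e.+2 [set x]) = good T.
      move: TS; rewrite inE => /andP[cT sT]. 
      by rewrite inE cT !inE sT.
    rewrite /good.
    have [z0|] /= := boolP (0 \in proj T).
      apply/orP; right; apply/orP; left; case/imsetP: z0 => -[g b] gT /= g0.
      by rewrite !zeroE TS; move: gT; rewrite -g0; case: b => ->; rewrite ?orbT.
    move=> _; rewrite andbT.
    have [/existsP[g gT]|/existsPn notwin] := boolP [exists g, ((g, false) \in T) && ((g, true) \in T)].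
      by apply/orP; right; apply/orP; right; apply/bigcupP; exists g => //; rewrite twinE TS.
    apply/orP; left; apply/imset_injP => -[g b] [g' b'] gT g'T /= gg'.
    rewrite -{}gg' in g'T *; have := notwin g.
    by case: b b' gT g'T => -[] // -> ->.
  apply: leq_trans (subset_leq_card sub) _.
  apply: leq_trans (leq_card_setU _ _) _; rewrite leq_add2l.
  apply: leq_trans (leq_card_setU _ _) _; apply: leq_add; first exact: leq_card_setU.
  apply: card_cover_le => T /bigcupP[g _ Tg]; by exists g.
have zeroB b : (e.+1`! * #|zero b| <= 2 * M ^ e)%N.
  apply: leq_trans (card_sum_sets_le e (x - letter_val (0, b))).
  by rewrite leq_pmul2l ?fact_gt0//; exact: card_sum_sets_mem.
have twinB : (e.+2`! * (\sum_g #|twin g|) <= e.+2`! * M ^ e)%N.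
  rewrite leq_pmul2l ?fact_gt0//.
  have step g : (#|twin g| <= #|sum_sets e x|)%N.
    have disj Y : ((g, true) \in Y :\ (g, false)) = ((g, true) \in Y).
      by rewrite in_setD1 xpair_eqE andbF.
    rewrite -(card_in_imset (f := fun Y => Y :\ (g, false) :\ (g, true))); last first.
      move=> Y Y'; rewrite !twinE => /and3P[_ f1 f2] /and3P[_ f3 f4] YY'.
      rewrite -(setD1K f1) -(@setD1K _ (g, true) (Y :\ (g, false))) ?disj// YY'.
      by rewrite !setD1K// disj.
    apply: subset_leq_card; apply/subsetP => T /imsetP[Y].
    rewrite twinE !inE => /and3P[/andP[/eqP cY /eqP sY] f1 f2] ->.
    have f3 : (g, true) \in Y :\ (g, false) by rewrite disj.
    move: cY sY; rewrite (cardsD1 (g, false) Y) f1 (cardsD1 (g, true) (Y :\ _)) f3.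
    move=> /eqP; rewrite !add1n !eqSS => ->; rewrite -{1}(setD1K f1) signed_sumU1 ?setD11//.
    rewrite -{1}(setD1K f3) signed_sumU1 ?setD11//.
    by rewrite /letter_val /= addNKr => ->; rewrite eqxx.
  apply: (@leq_trans (\sum_(g : G) #|sum_sets e x|)%N); first exact: leq_sum.
  (* For d = 2 the set left after removing an opposite pair is empty, and its sum 0 differs from
     x. *)
  rewrite sum_nat_const; case: (e) => [|e'].
    by rewrite card_sum_sets0 (negbTE x0) muln0.
  rewrite expnS -mulnA (mulnC 2%N) -mulnA leq_pmul2l ?fact_gt0; last by apply/card_gt0P; exists 0.
  rewrite mulnC; apply: leq_trans (card_sum_sets_le e' x); exact: leq_pmull (fact_gt0 _).
have fe : (e.+1 <= e.+1`!)%N by rewrite factS leq_pmulr// fact_gt0.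
have := card_sum_sets_ge oddG e.+1 x; rewrite succnK => ge.
have cov' := leq_mul (leqnn e.+2`!) cov.
have z0 := leq_mul (leqnn e.+2) (zeroB false).
have z1 := leq_mul (leqnn e.+2) (zeroB true).
(* The constant 6: five copies of (e + 2)! absorb the counting error and the two classes of letters
   over 0, one more the opposite pairs. *)
have pow : (e.+1 * e.+2 * M ^ e + e.+2 * (2 * M ^ e) + e.+2 * (2 * M ^ e) + e.+2`! * M ^ e <=
    e.+2`! * (6 * M ^ e))%N.
  have : (4 * e.+2 + e.+1 * e.+2 <= 5 * e.+2`!)%N.
    rewrite factS -mulnDl mulnCA mulnC leq_pmul2l//; lia.
  by move: (M ^ e)%N (e.+2`!) => X f; nia.
rewrite mulnA -factS in z0; rewrite mulnA -factS in z1; rewrite !mulnDr in cov'.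
rewrite mulnDr; move: ge cov' z0 z1 twinB pow; clear.
by do 6!(let h := fresh in move=> h); lia.
Qed.

End Families.

(** * Pairs of representations with common elements *)

Section Overlaps.
Import mathcomp.boot.fintype mathcomp.boot.finset.
Variable G : finZmodType.
Hypothesis oddG : odd #|G|.
Local Notation letter := (G * bool)%type.
Local Notation M := (2 * #|G|)%N.
Implicit Types (u x : G) (h : letter) (T Y : {set letter}) (Z : {set G}).

Lemma card_sum_sets_leW j u : (#|sum_sets j.+1 u| <= 2 * M ^ j)%N.
Proof.
by apply: leq_trans (card_sum_sets_le j u); rewrite leq_pmull// fact_gt0.
Qed.

Lemma signed_sumID T Y : signed_sum T = signed_sum (T :&: Y) + signed_sum (T :\: Y).
Proof. exact: big_setID. Qed.

Lemma card_proj T : good T -> #|proj T| = #|T|.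
Proof. by case/andP => /eqP. Qed.

(* T' is recovered from its part X over proj T and the remaining j + 1 letters,
   whose sum is prescribed by X. *)
Lemma overlap_family_le k j Z T : #|T| = (k + j.+1)%N -> good T ->
  (#|[set T' in family (k + j.+1) Z | #|proj T :&: proj T'| == k]| <=
   4 ^ (k + j.+1) * (#|Z| * (2 * M ^ j)))%N.
Proof.
move=> cT gT; pose pre := [set h : letter | h.1 \in proj T].
have cpre : #|pre| = (2 * (k + j.+1))%N.
  have -> : pre = setX (proj T) setT by apply/setP => -[g b]; rewrite !inE andbT.
  by rewrite cardsX cardsT card_bool card_proj// cT mulnC.
pose F (Xz : {set letter} * G) := [set T' : {set letter} | (T' :&: pre == Xz.1) &&
   (T' :\: pre \in sum_sets j.+1 (Xz.2 - signed_sum Xz.1))].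
apply: (@leq_trans (\sum_(Xz in setX (powerset pre) Z) #|F Xz|)).
  apply: card_cover_le => T'; rewrite !inE.
  move=> /andP[/and3P[/eqP cT' sZ gT'] /eqP kE].
  exists (T' :&: pre, signed_sum T'); first by rewrite !inE subsetIr.
  rewrite !inE eqxx/= (signed_sumID T' pre) addrC addKr eqxx andbT.
  suff kE' : #|T' :&: pre| = k.
    by rewrite -(eqn_add2l k) -{1}kE' cardsID cT'.
  rewrite -kE (setIC (proj T)); have -> : proj T' :&: proj T = proj (T' :&: pre).
    apply/setP => g; rewrite inE; apply/andP/imsetP => [[/imsetP[h hT' ->] gpT]|[h]].
      by exists h => //; rewrite !inE hT'.
    by rewrite !inE => /andP[hT' hT] ->; split => //; apply/imsetP; exists h.
  rewrite /proj card_in_imset// => h h'; rewrite !inE => /andP[hT' _] /andP[hT'' _].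
  exact: (good_inj gT').
apply: (@leq_trans (\sum_(Xz in setX (powerset pre) Z) 2 * M ^ j)%N).
  apply: leq_sum => -[X z] _; apply: leq_trans (card_sum_sets_leW j (z - signed_sum X)).
  rewrite -(card_in_imset (f := fun Y => Y :\: pre)); last first.
    move=> Y Y'; rewrite !inE/= => /andP[/eqP YX _] /andP[/eqP Y'X _] YY'.
    by rewrite -(setID Y pre) YX YY' -Y'X setID.
  by apply: subset_leq_card; apply/subsetP => Y /imsetP[T']; rewrite inE/= => /andP[_ +] ->.
by rewrite sum_nat_const cardsX card_powerset cpre expnM -mulnA.
Qed.

Definition flip h : letter := (h.1, ~~ h.2).

Lemma flipK : involutive flip.
Proof. by case=> g b; rewrite /flip /= negbK. Qed.

Lemma letter_val_flip h : letter_val (flip h) = - letter_val h.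
Proof. by case: h => g []; rewrite /letter_val /= ?opprK. Qed.

Lemma letter_eq_flip h h' : h.1 = h'.1 -> h != h' -> h' = flip h.
Proof. by case: h h' => g b [g' b'] /= <-; rewrite /flip/=; case: b b' => -[] //; rewrite eqxx. Qed.

Lemma setD_same_proj T T' : good T -> good T' -> proj T = proj T' ->
  T' :\: T = flip @: (T :\: T').
Proof.
move=> gT gT' pp; apply/setP => h; rewrite inE; apply/andP/imsetP => [[hT hT']|[h' + ->]].
  have /imsetP[h' h'T hh'] : h.1 \in proj T by rewrite pp; apply/imsetP; exists h.
  have h'h : h' != h by apply: contraNneq hT => <-.
  have hE := letter_eq_flip (esym hh') h'h.
  exists h' => //; rewrite inE h'T andbT; apply/negP => h'T'.
  by move/eqP: h'h; apply; exact: (good_inj gT').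
rewrite inE => /andP[h'T' h'T].
have /imsetP[h'' h''T' h''h'] : h'.1 \in proj T' by rewrite -pp; apply/imsetP; exists h'.
have h'h'' : h' != h'' by apply: contraNneq h'T' => ->.
have hE := letter_eq_flip h''h' h'h''; rewrite -hE; split => //.
by apply/negP => h''T; move/eqP: h'h''; apply; exact: (good_inj gT).
Qed.

Lemma signed_sum_flip T : signed_sum (flip @: T) = - signed_sum T.
Proof.
rewrite /signed_sum big_imset/=; last by move=> h h' _ _; exact: (inv_inj flipK).
by rewrite -sumrN; apply: eq_bigr => h _; rewrite letter_val_flip.
Qed.

(* T' is T with the signs of T :\: T' flipped. Halving the sum and the difference
   of the two signed sums prescribes the sums over T :&: T' and T :\: T'; the
   hypothesis on Z rules out T :&: T' = set0. *)
Lemma same_proj_family_le e Z : {in Z &, forall z z', z + z' != 0} ->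
  (#|[set TT : {set letter} * {set letter} | [&& TT.1 \in family e.+2 Z,
      TT.2 \in family e.+2 Z, TT.1 != TT.2 & proj TT.1 == proj TT.2]]| <=
   #|Z| * #|Z| * (e.+1 * (4 * M ^ e)))%N.
Proof.
move=> Z0.
pose F (zb : (G * G) * 'I_e.+1) := [set TT : {set letter} * {set letter} |
  [&& good TT.1, good TT.2, proj TT.1 == proj TT.2,
   TT.1 :&: TT.2 \in sum_sets zb.2.+1 (half (zb.1.1 + zb.1.2)) &
   TT.1 :\: TT.2 \in sum_sets (e - zb.2).+1 (half (zb.1.1 - zb.1.2))]].
apply: (@leq_trans (\sum_(zb in setX (setX Z Z) setT) #|F zb|)).
  apply: card_cover_le => -[T T']; rewrite inE/=.
  case/and4P; rewrite inE => /and3P[/eqP cT sZ gT].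
  rewrite inE => /and3P[/eqP cT' sZ' gT'] TT' /eqP pp.
  have sT := signed_sumID T T'; have sT' := signed_sumID T' T.
  rewrite setIC setD_same_proj// signed_sum_flip in sT'.
  have A0 : (0 < #|T :&: T'|)%N.
    rewrite lt0n cards_eq0; apply/negP => /eqP A0; have := Z0 _ _ sZ sZ'.
    by rewrite sT sT' A0 /signed_sum big_set0 !add0r subrr eqxx.
  have B0 : (0 < #|T :\: T'|)%N.
    rewrite lt0n cards_eq0 setD_eq0; apply: contraNN TT' => sub.
    by rewrite eqEcard sub cT cT' leqnn.
  have AB := cardsID T' T; rewrite cT in AB.
  have bP : (#|T :&: T'|.-1 < e.+1)%N by lia.
  exists ((signed_sum T, signed_sum T'), Ordinal bP); first by rewrite !inE sZ sZ'.
  rewrite inE/= gT gT' pp eqxx/= !inE prednK// eqxx/=.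
  have -> : half (signed_sum T + signed_sum T') = signed_sum (T :&: T').
    by rewrite sT sT' addrACA subrr addr0 -mulr2n mulr2n_half.
  have -> : half (signed_sum T - signed_sum T') = signed_sum (T :\: T').
    by rewrite sT sT' opprD opprK addrACA subrr add0r -mulr2n mulr2n_half.
  rewrite !eqxx/= andbT; apply/eqP.
  by move: A0 B0 AB; clear; move: #|T :&: T'| #|T :\: T'| => a b; lia.
apply: (@leq_trans (\sum_(zb in setX (setX Z Z) [set: 'I_e.+1]) 4 * M ^ e)%N).
  apply: leq_sum => -[[z z'] b] _.
  apply: (@leq_trans #|setX (sum_sets b.+1 (half (z + z'))) (sum_sets (e - b).+1 (half (z - z')))|).
    rewrite -(card_in_imset (f := fun TT => (TT.1 :&: TT.2, TT.1 :\: TT.2))); last first.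
      move=> [T1 T2] [T3 T4]; rewrite !inE/=.
      move=> /and3P[g1 g2 /andP[/eqP p12 _]] /and3P[g3 g4 /andP[/eqP p34 _]] [AE BE].
      have E13 : T1 = T3 by rewrite -(setID T1 T2) AE BE setID.
      suff E24 : T2 = T4 by rewrite E13 E24.
      rewrite -(setID T2 T1) -(setID T4 T3) (setD_same_proj g1 g2 p12) (setD_same_proj g3 g4 p34).
      by rewrite BE setIC AE setIC.
    apply: subset_leq_card; apply/subsetP => AB /imsetP[[T T']]; rewrite !inE/=.
    by move=> /and5P[_ _ _ P Q] -> /=; rewrite P Q.
  rewrite cardsX; apply: leq_trans (leq_mul (card_sum_sets_leW _ _) (card_sum_sets_leW _ _)) _.
  by rewrite mulnACA -expnD subnKC// -ltnS.
by rewrite sum_nat_const !cardsX cardsT card_ord -!mulnA.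
Qed.

End Overlaps.

Section OverlapSum.
Import mathcomp.boot.fintype mathcomp.boot.finset.
Variables (R : realType) (G : finZmodType).
Hypothesis oddG : odd #|G|.
Local Notation letter := (G * bool)%type.
Implicit Types (x : G) (T : {set letter}) (Z K S : {set G}).

(** Probability 0 at the group element 0 lets the random subset of the nonzero elements be a product
    measure over the whole group. *)
Definition edge_prob (q : R) (g : G) : R := if g == 0 then 0 else q.

Variable q : R.
Hypothesis q01 : 0 <= q <= 1.
Local Notation prb := (edge_prob q).

Lemma edge_prob01 g : 0 <= prb g <= 1.
Proof. by rewrite /edge_prob; case: ifP => // _; rewrite lexx ler01. Qed.

Lemma incl_prob_edge K : 0 \notin K -> incl_prob prb K = q ^+ #|K|.
Proof.
move=> K0; rewrite -prodr_const; apply: eq_bigr => g gK.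
by rewrite /edge_prob; case: eqP => // g0; rewrite -g0 gK in K0.
Qed.

Lemma incl_prob_le K : incl_prob prb K <= q ^+ #|K|.
Proof.
rewrite -prodr_const; apply: ler_prod => g gK.
by rewrite /edge_prob; case/andP: q01 => q0 _; case: ifP; rewrite ?lexx ?q0.
Qed.

Local Notation N := (#|G|%:R : R).
Local Notation M := (2 * #|G|%:R : R).

Variable e : nat.
Let L : R := M ^+ e.+1 * q ^+ e.+2.
Let y : R := M * q.
Hypothesis y1 : 1 <= y.

Let q0 : 0 <= q. Proof. by case/andP: q01. Qed.
Let cardG_gt0 : 0 < N. Proof. by rewrite ltr0n; apply/card_gt0P; exists 0. Qed.
Let M0 : 0 < M. Proof. by rewrite mulr_gt0. Qed.
Let MN : M = (2 * #|G|)%:R. Proof. by rewrite natrM. Qed.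
Let L0 : 0 <= L. Proof. by rewrite mulr_ge0// exprn_ge0// ltW. Qed.

(** Pairs with equal supports contribute O(M^(d-2) q^d) = O(L/M). Pairs sharing k + 1 < d elements
    contribute O(M^(d-1) M^(e-k) q^(2d-k-1)) = O(L^2 / y^(k+1)), which is at most O(L^2 / y) since y
    >= 1. *)
Lemma overlap_sum_le Z : (#|Z| <= 2)%N -> {in Z &, forall z z', z + z' != 0} ->
  \sum_(T in family e.+2 Z) \sum_(T' in family e.+2 Z |
      (T' != T) && ~~ [disjoint proj T & proj T'])
    incl_prob prb (proj T :|: proj T') <=
  (16 * 4 ^ e.+2 * e.+1)%:R * (L ^+ 2 / y + L / M).
Proof.
move=> Z2 Z0.
pose same T T' := (T != T') && (proj T == proj T').
pose inter k T T' := #|proj T :&: proj T'| == k.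
apply: (@le_trans _ _ (\sum_(T in family e.+2 Z) \sum_(T' in family e.+2 Z)
   ((same T T')%:R * q ^+ e.+2 + \sum_(k < e.+1) (inter k.+1 T T')%:R * q ^+ (2 * e.+2 - k.+1)))).
  apply: ler_sum => T; rewrite inE => /and3P[/eqP cT _ gT].
  rewrite [leLHS]big_mkcondr/=; apply: ler_sum => T'; rewrite inE => /and3P[/eqP cT' _ gT'].
  have s0 : 0 <= \sum_(k < e.+1) (inter k.+1 T T')%:R * q ^+ (2 * e.+2 - k.+1).
    by apply: sumr_ge0 => k _; rewrite mulr_ge0// exprn_ge0.
  case: ifP => [/andP[T'T ndis]|_]; last by rewrite addr_ge0// mulr_ge0// exprn_ge0.
  have ZU : 0 \notin proj T :|: proj T'.
    by rewrite inE negb_or; case/andP: gT => _ ->; case/andP: gT' => _ ->.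
  rewrite (incl_prob_edge ZU) cardsU !card_proj// cT cT'.
  have [pp|pp] := eqVneq (proj T) (proj T').
    rewrite /same eq_sym T'T pp eqxx/= setIid card_proj// cT' addnK mul1r.
    by rewrite lerDl.
  have kb : (#|proj T :&: proj T'| < e.+2)%N.
    rewrite -cT -card_proj// ltn_neqAle subset_leq_card ?subsetIl// andbT.
    apply/negP => /eqP cI; move/eqP: pp; apply; apply/eqP.
    have sub : proj T \subset proj T'.
      have /eqP <- : proj T :&: proj T' == proj T by rewrite eqEcard subsetIl cI leqnn.
      exact: subsetIr.
    by rewrite eqEcard sub (card_proj gT) (card_proj gT') cT cT' leqnn.
  have kp : (0 < #|proj T :&: proj T'|)%N by rewrite lt0n cards_eq0 setI_eq0.
  have kb' : (#|proj T :&: proj T'|.-1 < e.+1)%N by rewrite prednK.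
  rewrite /same (negbTE pp) andbF mul0r add0r (bigD1 (Ordinal kb'))//= /inter prednK// eqxx.
  rewrite mul1r mul2n -addnn lerDl; apply: sumr_ge0 => k _; rewrite mulr_ge0// exprn_ge0//.
under eq_bigr do rewrite big_split/=.
rewrite big_split/= mulrDr addrC; apply: lerD; last first.
  under eq_bigr do rewrite -mulr_suml.
  rewrite -mulr_suml.
  have -> : \sum_(T in family e.+2 Z) \sum_(T' in family e.+2 Z) (same T T')%:R =
     #|[set TT : {set letter} * {set letter} | [&& TT.1 \in family e.+2 Z,
      TT.2 \in family e.+2 Z, TT.1 != TT.2 & proj TT.1 == proj TT.2]]|%:R :> R.
    rewrite pair_big_dep/= -sum1dep_card natr_sum [RHS]big_mkcond [LHS]big_mkcond/=.
    apply: eq_bigr => -[T T'] _ /=.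
    by case: (T \in family _ _); case: (T' \in family _ _) => //=; rewrite -/(same T T'); case: (same T T').
  have -> : L / M = M ^+ e * q ^+ e.+2.
    apply: (@mulIf _ M); first by rewrite gt_eqF.
    by rewrite divfK ?gt_eqF// /L exprS; ring.
  rewrite mulrA; apply: ler_wpM2r; first exact: exprn_ge0.
  rewrite MN -natrX -natrM ler_nat; apply: leq_trans (same_proj_family_le oddG e Z0) _.
  apply: (@leq_trans (2 * 2 * (e.+1 * (4 * (2 * #|G|) ^ e)))); first by rewrite leq_mul// leq_mul.
  have : (1 <= 4 ^ e.+2)%N by rewrite expn_gt0.
  by move: (4 ^ e.+2)%N ((2 * #|G|) ^ e)%N => c X c1; rewrite !mulnA leq_mul// mulnAC leq_mul// leq_pmulr.
have card_fam : (#|family e.+2 Z| <= 4 * (2 * #|G|) ^ e.+1)%N.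
  rewrite card_family_sum; apply: (@leq_trans (\sum_(z in Z) 2 * (2 * #|G|) ^ e.+1)%N).
    apply: leq_sum => z _; apply: leq_trans (card_family_le e.+1 z).
    by rewrite leq_pmull// fact_gt0.
  by rewrite sum_nat_const mulnA leq_mul2r (@leq_mul _ 2 2 2)// orbT.
apply: (@le_trans _ _ (\sum_(T in family e.+2 Z) \sum_(k < e.+1)
   (4 * 4 ^ e.+2)%:R * M ^+ (e - k) * q ^+ (2 * e.+2 - k.+1))).
  apply: ler_sum => T; rewrite inE => /and3P[/eqP cT _ gT].
  rewrite exchange_big/=; apply: ler_sum => k _; rewrite -mulr_suml.
  apply: ler_wpM2r; first exact: exprn_ge0.
  rewrite -natr_sum MN -natrX -natrM ler_nat.
  have ke : (e.+2 = k.+1 + (e - k).+1)%N by rewrite addnS addSn subnKC// -ltnS.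
  have := @overlap_family_le G k.+1 (e - k) Z T; rewrite -ke => /(_ cT gT) H.
  have -> : (\sum_(T' in family e.+2 Z) inter k.+1 T T' =
     #|[set T' in family e.+2 Z | #|proj T :&: proj T'| == k.+1]|)%N.
    rewrite -sum1dep_card [LHS]big_mkcond [RHS]big_mkcond/=; apply: eq_bigr => T' _.
    by rewrite /inter; case: (T' \in _) => //=; case: ifP.
  apply: leq_trans H _; rewrite [(4 * 4 ^ _)%N]mulnC -[leqRHS]mulnA leq_mul2l; apply/orP; right.
  by rewrite mulnA leq_mul2r (@leq_mul _ 2 2 2)// orbT.
rewrite sumr_const -[leLHS]mulr_natl.
have term (k : 'I_e.+1) : M ^+ e.+1 * (M ^+ (e - k) * q ^+ (2 * e.+2 - k.+1)) <= L ^+ 2 / y.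
  have y0 : 0 < y by apply: lt_le_trans y1.
  have -> : M ^+ e.+1 * (M ^+ (e - k) * q ^+ (2 * e.+2 - k.+1)) = L ^+ 2 / y ^+ k.+1.
    apply: (@mulIf _ (y ^+ k.+1)); first by rewrite gt_eqF// exprn_gt0.
    rewrite divfK; last by rewrite gt_eqF// exprn_gt0.
    rewrite /L /y; move: (M) (ltn_ord k) => m ke.
    rewrite [(m * q) ^+ _]exprMn [(_ ^+ _ * _ ^+ _) ^+ 2]exprMn -!exprM mulrA mulrACA -!exprD.
    by congr (_ ^+ _ * _ ^+ _); lia.
  rewrite ler_wpM2l ?exprn_ge0// lef_pV2 ?posrE ?exprn_gt0//.
  by rewrite exprS ler_peMr ?(ltW y0)// exprn_ege1.
apply: (@le_trans _ _ ((4 * (2 * #|G|) ^ e.+1)%:R * \sum_(k < e.+1)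
   (4 * 4 ^ e.+2)%:R * M ^+ (e - k) * q ^+ (2 * e.+2 - k.+1))).
  apply: ler_wpM2r; last by rewrite ler_nat.
  apply: sumr_ge0 => k _; rewrite !mulr_ge0// ?exprn_ge0// ltW.
rewrite natrM natrX -MN mulr_sumr.
apply: (@le_trans _ _ (\sum_(k < e.+1) (16 * 4 ^ e.+2)%:R * (L ^+ 2 / y))).
  apply: ler_sum => k _; have := term k.
  set Y := _ / y => tk.
  rewrite (_ : _ * _ = (16 * 4 ^ e.+2)%:R * (M ^+ e.+1 * (M ^+ (e - k) * q ^+ (2 * e.+2 - k.+1)))).
    by rewrite ler_wpM2l.
  by rewrite !natrM; ring.
rewrite sumr_const card_ord -[leLHS]mulr_natl mulrA -natrM (mulnC e.+1).
by rewrite lexx.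
Qed.

End OverlapSum.

(** * Defects *)

Section Reach.
Import mathcomp.boot.fintype mathcomp.boot.finset.
Variable G : finZmodType.
Local Notation letter := (G * bool)%type.
Implicit Types (x : G) (T : {set letter}) (Z K S : {set G}).

(* Letters with first component 0 pad shorter words to length d. *)
Definition walk d S x (w : {ffun 'I_d -> letter}) :=
  [forall i, (w i).1 \in 0 |: S] && (\sum_i letter_val (w i) == x).

Definition reach d S x := [exists w : {ffun 'I_d -> letter}, walk S x w].

Definition support d (w : {ffun 'I_d -> letter}) : {set G} := [set (w i).1 | i : 'I_d] :\ 0.

(* A given x may be reached by far more short words than average, e.g. when
   3 a = x has many solutions a, so these are only counted on average over x. *)
Definition short_reach d S x :=
  [exists w : {ffun 'I_d -> letter}, walk S x w && (#|support w| < d)%N].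

Lemma walkS d S S' x (w : {ffun 'I_d -> letter}) : S \subset S' -> walk S x w -> walk S' x w.
Proof.
rewrite /walk => SS' /andP[/forallP wS ->]; rewrite andbT; apply/forallP => i.
by have := wS i; apply/subsetP; exact: setUS.
Qed.

Lemma reachS d S S' x : S \subset S' -> reach d S x -> reach d S' x.
Proof. by move=> SS' /existsP[w /(walkS SS')] ?; apply/existsP; exists w. Qed.

Lemma short_reachS d S S' x : S \subset S' -> short_reach d S x -> short_reach d S' x.
Proof.
by move=> SS' /existsP[w /andP[/(walkS SS') ? ?]]; apply/existsP; exists w; apply/andP.
Qed.

Lemma reachN d S x : reach d S (- x) = reach d S x.
Proof.
have imp u : reach d S u -> reach d S (- u).
  case/existsP => w /andP[/forallP wS /eqP wx]; apply/existsP.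
  exists [ffun i => flip (w i)]; apply/andP; split.
    by apply/forallP => i; rewrite ffunE; exact: wS.
  rewrite -wx -sumrN; apply/eqP; apply: eq_bigr => i _.
  by rewrite ffunE letter_val_flip.
by apply/idP/idP => /imp //; rewrite opprK.
Qed.

Lemma family_reach d Z S T : T \in family d Z -> proj T \subset S ->
  exists2 z, z \in Z & reach d S z.
Proof.
rewrite inE => /and3P[/eqP cT sZ _] TS; exists (signed_sum T) => //.
apply/existsP; exists [ffun i => enum_val (cast_ord (esym cT) i)]; apply/andP; split.
  apply/forallP => i; rewrite ffunE in_setU; apply/orP; right.
  apply: (subsetP TS); apply/imsetP; eexists; last by [].
  exact: enum_valP.
apply/eqP; rewrite /signed_sum [RHS]big_enum_val /=.
rewrite [RHS](reindex (cast_ord (esym cT)))/=.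
  by apply: eq_bigr => i _; rewrite ffunE.
by apply: onW_bij; exists (cast_ord cT) => i; rewrite ?cast_ordK ?cast_ordKV.
Qed.

(** A walk of length d whose support has at least d nonzero elements repeats none of them and
    contains no padding, so its letters form a good set. *)
Lemma reach_family d S x : reach d S x -> ~~ short_reach d S x ->
  exists2 T, T \in family d [set x] & proj T \subset S.
Proof.
case/existsP => w wx; move/existsPn/(_ w); rewrite wx/= -leqNgt => sw.
case/andP: wx => /forallP wS /eqP wx.
pose W := [set (w i).1 | i : 'I_d].
have cW : (#|W| <= d)%N by rewrite -[X in (_ <= X)%N]card_ord leq_imset_card.
have W0 : 0 \notin W.
  by apply/negP => W0; move: cW; rewrite (cardsD1 0 W) W0 add1n ltnNge sw.
have cWd : #|W| = d.
  by apply/eqP; rewrite eqn_leq cW; move: sw; rewrite /support -/W (cardsD1 0 W) (negbTE W0).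
have injW : {in predT &, injective (fun i => (w i).1)}.
  by apply/imset_injP; rewrite -/W cWd card_ord.
have injw : injective w by move=> i j wij; apply: injW => //; rewrite wij.
exists [set w i | i : 'I_d]; last first.
  apply/subsetP => g /imsetP[h /imsetP[i _ ->] ->].
  have := wS i; rewrite in_setU1 => /orP[/eqP w0|//].
  by case/negP: W0; apply/imsetP; exists i.
have pE : proj [set w i | i : 'I_d] = W by rewrite /proj -imset_comp.
rewrite inE /good pE cWd card_imset// card_ord eqxx W0 andbT /=.
rewrite inE /signed_sum big_imset/=; last by move=> i j _ _; exact: injw.
by rewrite andbT; apply/eqP.
Qed.

(** A target of a short walk is determined by the support K and a word of length d over the letters
    above K and 0, of which there are at most 2 d. *)
Lemma card_short_reach_le d S :
  (#|[set x | short_reach d S x]| <=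
   \sum_(K : {set G} | [&& (#|K| < d)%N, 0%R \notin K & K \subset S]) (2 * d) ^ d)%N.
Proof.
pose F K : {set G} := [set \sum_i letter_val (w i) | w : {ffun 'I_d -> letter} in
   ffun_on [set h : letter | h.1 \in 0 |: K]].
apply: (@leq_trans (\sum_(K : {set G} | [&& (#|K| < d)%N, 0%R \notin K & K \subset S]) #|F K|)).
  apply: card_cover_le => x; rewrite inE => /existsP[w /andP[/andP[/forallP wS /eqP wx] cw]].
  exists (support w).
    rewrite cw setD11/=; apply/subsetP => g; rewrite in_setD1 => /andP[g0 /imsetP[i _ gE]].
    by have := wS i; rewrite -gE in_setU1 (negbTE g0).
  apply/imsetP; exists w => //; apply/ffun_onP => i; rewrite inE in_setU1 in_setD1.
  by case: eqVneq => //= _; apply/imsetP; exists i.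
apply: leq_sum => K /and3P[Kd K0 _]; apply: leq_trans (leq_imset_card _ _) _.
rewrite card_ffun_on card_ord; case: (d) Kd => [//|d'] Kd.
rewrite leq_exp2r//.
have -> : [set h : letter | h.1 \in 0 |: K] = setX (0 |: K) setT.
  by apply/setP => -[g b]; rewrite !inE andbT.
by rewrite cardsX cardsT card_bool cardsU1 K0 mulnC leq_mul2l.
Qed.

End Reach.

(** * Probabilities of defects *)

Section DefectProbability.
Import mathcomp.boot.fintype mathcomp.boot.finset.
Variables (R : realType) (G : finZmodType).
Hypothesis oddG : odd #|G|.
Local Notation letter := (G * bool)%type.
Implicit Types (x : G) (T : {set letter}) (Z K S : {set G}).
Variable q : R.
Hypothesis q01 : 0 <= q <= 1.
Local Notation prb := (@edge_prob R G q).
Local Notation N := (#|G|%:R : R).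
Local Notation M := (2 * #|G|%:R : R).
Variable e : nat.
Let L : R := M ^+ e.+1 * q ^+ e.+2.
Let y : R := M * q.
Hypothesis y1 : 1 <= y.
(* the mean number of signed d-subsets of S with a given sum, up to lower order *)
Let mu : R := 2 * L / e.+2`!%:R.

Let q0 : 0 <= q. Proof. by case/andP: q01. Qed.
Let N0 : 0 < N. Proof. by rewrite ltr0n; apply/card_gt0P; exists 0. Qed.
Let M0 : 0 < M. Proof. by rewrite mulr_gt0. Qed.
Let MN : M = (2 * #|G|)%:R. Proof. by rewrite natrM. Qed.
Let f0 : 0 < e.+2`!%:R :> R. Proof. by rewrite ltr0n fact_gt0. Qed.
Let p01 := @edge_prob01 R G q q01.

(** The first summand is the constant of the overlap sum; 12 is 6 for each of at most two targets,
    from the lower bound on the number of generic sets. *)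
Definition defect_const : R := (16 * 4 ^ e.+2 * e.+1 + 12)%:R.

Let err : R := defect_const * (L ^+ 2 / y + L / M).

Let L_M : L / M = M ^+ e * q ^+ e.+2.
Proof.
apply: (@mulIf _ M); first by rewrite gt_eqF.
by rewrite divfK ?gt_eqF// /L exprS; ring.
Qed.

Let L0 : 0 <= L. Proof. by rewrite mulr_ge0// exprn_ge0// ltW. Qed.

(** Janson's inequality for the supports of all generic representations of elements of [Z] together.
    One statement serves a single vertex and a pair of non-opposite vertices. *)
Lemma defect_prob_le Z : (#|Z| <= 2)%N -> {in Z &, forall z z', z + z' != 0} ->
  Ex prb (fun S => [forall z in Z, ~~ reach e.+2 S z]%:R) <=
  expR (- (#|Z|%:R * mu) + err).
Proof.
move=> Z2 Z0; pose s := enum (family e.+2 Z).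
apply: (@le_trans _ _ (Ex prb (avoid R (@proj G) s))).
  apply: le_Ex => // S; rewrite avoidE ler_nat; case: (boolP (all _ _)) => [_|]; first exact: leq_b1.
  move/allPn => [T]; rewrite mem_enum negbK => TF TS.
  have [z zZ zS] := family_reach TF TS.
  by rewrite leqn0 eqb0; apply/forallPn; exists z; rewrite zZ negbK.
apply: le_trans (janson p01 _ (enum_uniq _)) _; rewrite ler_expR.
have := overlap_sum_le oddG q01 e y1 Z2 Z0; rewrite -/L -/y => overlap.
rewrite -/s big_enum/=.
have -> : \sum_(a <- s) \sum_(b <- s | (b != a) && ~~ [disjoint proj a & proj b])
   incl_prob prb (proj a :|: proj b) =
  \sum_(T in family e.+2 Z) \sum_(T' in family e.+2 Z |
      (T' != T) && ~~ [disjoint proj T & proj T'])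
    incl_prob prb (proj T :|: proj T').
  by rewrite big_enum/=; apply: eq_bigr => T _; rewrite big_enum_cond.
have lower : #|Z|%:R * mu - 12 * (L / M) <= \sum_(T in family e.+2 Z) incl_prob prb (proj T).
  have -> : \sum_(T in family e.+2 Z) incl_prob prb (proj T) = #|family e.+2 Z|%:R * q ^+ e.+2.
    rewrite mulr_natl -sumr_const; apply: eq_bigr => T.
    rewrite inE => /and3P[/eqP cT _ gT]; rewrite incl_prob_edge ?card_proj ?cT//.
    by case/andP: gT.
  have card_z z : z \in Z -> mu - 6 * (L / M) <= #|family e.+2 [set z]|%:R * q ^+ e.+2.
    (* The hypothesis on [Z] applied to z twice gives 2 z != 0, hence z != 0. *)
    move=> zZ; have z0 : z != 0.
      by apply/negP => /eqP z0; have := Z0 z z zZ zZ; rewrite z0 addr0 eqxx.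
    have H : 2 * M ^+ e.+1 <= e.+2`!%:R * (#|family e.+2 [set z]|%:R + 6 * M ^+ e).
      by rewrite MN -!natrX -!natrM -natrD -natrM ler_nat; exact: card_family_ge.
    rewrite [leRHS]mulrC -ler_pdivrMr// in H.
    have H2 := ler_wpM2r (exprn_ge0 e.+2 q0) H.
    rewrite [leRHS]mulrDl -lerBlDr in H2; apply: le_trans H2; rewrite L_M /mu /L.
    by rewrite le_eqVlt; apply/orP; left; apply/eqP; ring.
  rewrite card_family_sum natr_sum mulr_suml.
  apply: (@le_trans _ _ (\sum_(z in Z) (mu - 6 * (L / M)))); last exact: ler_sum.
  rewrite sumr_const -[leRHS]mulr_natl.
  have LM0 : 0 <= L / M by rewrite divr_ge0// ltW.
  have /(ler_wpM2r LM0) : (#|Z|%:R <= 2 :> R) by rewrite ler_nat.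
  by move: (#|Z|%:R : R) (L / M) => c a; lra.
have LM0 : 0 <= L / M by rewrite divr_ge0// ltW.
have y0 : 0 < y by apply: lt_le_trans y1.
have Ly0 : 0 <= L ^+ 2 / y by rewrite divr_ge0 ?exprn_ge0// ltW.
have -> : err = (16 * 4 ^ e.+2 * e.+1)%:R * (L ^+ 2 / y + L / M) + 12 * (L ^+ 2 / y + L / M).
  by rewrite /err /defect_const natrD mulrDl.
lra.
Qed.

Lemma one_sub_ge_expR (t : R) : 0 <= t < 1 -> expR (- (t / (1 - t))) <= 1 - t.
Proof.
move=> /andP[t0 t1]; have t1' : 0 < 1 - t by rewrite subr_gt0.
rewrite expRN -[leRHS]invrK lef_pV2 ?posrE ?invr_gt0 ?expR_gt0//.
apply: le_trans (expR_ge1Dx _); rewrite le_eqVlt; apply/orP; left; apply/eqP.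
by field; rewrite gt_eqF.
Qed.

(** A vertex is a defect as soon as no short walk reaches it and no generic representation is
    present. These are decreasing events, so Harris bounds the probability below by the product over
    all representations, and 1 - t >= exp(- t / (1 - t)) turns that product into an exponential. *)
Lemma defect_prob_ge x : q ^+ e.+2 < 1 ->
  (1 - Ex prb (fun S => (short_reach e.+2 S x)%:R)) * expR (- (mu / (1 - q ^+ e.+2))) <=
  Ex prb (fun S => (~~ reach e.+2 S x)%:R).
Proof.
move=> qd1; pose s := enum (family e.+2 [set x]).
have qd0 : 0 <= q ^+ e.+2 by rewrite exprn_ge0.
have anti1 : antitone (fun S => 1 - (short_reach e.+2 S x)%:R : R).
  move=> S S' SS'; rewrite lerB// ler_nat.
  by case: (boolP (short_reach _ S x)) => [/(short_reachS SS') ->|//].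
have upper : #|family e.+2 [set x]|%:R * q ^+ e.+2 <= mu.
  have H : e.+2`!%:R * #|family e.+2 [set x]|%:R <= 2 * M ^+ e.+1 :> R.
    by rewrite MN -!natrX -!natrM ler_nat; exact: card_family_le.
  rewrite [leLHS]mulrC -ler_pdivlMr// in H.
  apply: le_trans (ler_wpM2r qd0 H) _.
  by rewrite le_eqVlt /mu /L; apply/orP; left; apply/eqP; ring.
apply: (@le_trans _ _ (Ex prb (fun S => (1 - (short_reach e.+2 S x)%:R) * avoid R (@proj G) s S))).
  apply: le_trans (harris_antitone p01 anti1 (@avoid_antitone _ _ _ _ s)).
  rewrite ExB Ex_cst; apply: ler_wpM2l.
    rewrite subr_ge0 -[leRHS](Ex_cst prb); by apply: le_Ex => // S; rewrite lern1 leq_b1.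
  apply: le_trans (harris_prod p01 _ _ _); last 2 first.
    by move=> T S; rewrite subr_ge0 incl_le1.
    by move=> T; exact: incl_antitone.
  apply: (@le_trans _ _ (\prod_(T <- s) (1 - q ^+ e.+2))).
    rewrite big_enum/= prodr_const.
    have /(lerXn2r #|family e.+2 [set x]|) := one_sub_ge_expR (introT andP (conj qd0 qd1)).
    rewrite !nnegrE expR_ge0 subr_ge0 (ltW qd1) => /(_ isT isT); apply: le_trans.
    rewrite -expRM_natl ler_expR mulrN lerN2 mulrA ler_wpM2r// invr_ge0 subr_ge0 ltW//.
  rewrite /s !big_enum/=; apply: ler_prod => T; rewrite inE => /and3P[/eqP cT _ gT].
  rewrite subr_ge0 (ltW qd1) ExB Ex_cst Ex_incl -/(incl_prob prb (proj T)).
  by rewrite lerB// -cT -card_proj// incl_prob_le.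
apply: le_Ex => // S; rewrite avoidE.
case: (boolP (short_reach _ S x)) => [_|sh]; first by rewrite subrr mul0r ler0n.
rewrite subr0 mul1r ler_nat; case: (boolP (reach _ S x)) => [rS|_]; last exact: leq_b1.
have [T TF TS] := reach_family rS sh.
rewrite leqn0 eqb0; apply/allPn; exists T; rewrite ?mem_enum//.
by rewrite negbK.
Qed.

(** The expected number of chosen k-sets is at most (N q)^k <= y^k <= y^(d-1) for k < d. At
    criticality this is o(N), so short walks reach a negligible proportion of the vertices. *)
Lemma sum_short_reach_le :
  \sum_x Ex prb (fun S => (short_reach e.+2 S x)%:R) <=
  ((2 * e.+2) ^ e.+2 * e.+2)%:R * y ^+ e.+1.
Proof.
have Nqy : 0 <= N * q <= y.
  by rewrite mulr_ge0 ?(ltW N0)//= /y -mulrA ler_peMl ?mulr_ge0 ?(ltW N0)// ler1n.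
rewrite -Ex_sum.
pose c := ((2 * e.+2) ^ e.+2)%N.
pose P K := (#|K| < e.+2)%N && (0 \notin K).
apply: (@le_trans _ _ (Ex prb (fun S => \sum_(K | P K) c%:R * incl R K S))).
  apply: le_Ex => // S.
  have -> : \sum_(x : G) (short_reach e.+2 S x)%:R = #|[set x | short_reach e.+2 S x]|%:R :> R.
    by rewrite -sum1dep_card natr_sum [RHS]big_mkcond/=; apply: eq_bigr => x _; case: short_reach.
  have := card_short_reach_le e.+2 S; rewrite -(ler_nat R) => /le_trans; apply.
  rewrite natr_sum le_eqVlt; apply/orP; left; apply/eqP.
  rewrite [LHS]big_mkcond [RHS]big_mkcond/=; apply: eq_bigr => K _.
  rewrite /P /incl; case: (#|K| < e.+2)%N => //=; case: (0 \notin K) => //=.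
  by case: (K \subset S); rewrite ?mulr1 ?mulr0.
rewrite Ex_sum.
have incl_le K : P K -> Ex prb (fun S => c%:R * incl R K S) <= \sum_(k < e.+2) (#|K| == k)%:R * (c%:R * q ^+ k).
  move=> /andP[Kd K0]; rewrite ExZ Ex_incl -/(incl_prob prb K).
  rewrite (bigD1 (Ordinal Kd))//= eqxx mul1r (incl_prob_edge q K0) lerDl.
  by apply: sumr_ge0 => k _; rewrite !mulr_ge0// exprn_ge0.
apply: le_trans (ler_sum _ incl_le) _; rewrite exchange_big/=.
apply: (@le_trans _ _ (\sum_(k < e.+2) c%:R * y ^+ e.+1)); last first.
  by rewrite sumr_const card_ord -[leLHS]mulr_natl mulrA -natrM mulnC.
apply: ler_sum => k _; rewrite -mulr_suml mulrCA ler_wpM2l//.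
apply: (@le_trans _ _ (N ^+ k * q ^+ k)).
  apply: ler_wpM2r; first exact: exprn_ge0.
  rewrite -natr_sum -natrX ler_nat.
  apply: (@leq_trans #|[set K : {set G} | #|K| == k]|).
    rewrite -sum1dep_card [leqRHS]big_mkcond [leqLHS]big_mkcond/=; apply: leq_sum => K _.
    by case: (P K) => //; case: eqP.
  rewrite card_draws; apply: (@leq_trans ('C(#|G|, k) * k`!)%N); first by rewrite leq_pmulr// fact_gt0.
  rewrite bin_ffact ffact_prod; apply: (@leq_trans (\prod_(i < k) #|G|)%N).
    by apply: leq_prod => i _; exact: leq_subr.
  by rewrite prod_nat_const card_ord.
rewrite -exprMn; case/andP: Nqy => Nq0 Nqy.
apply: (@le_trans _ _ (y ^+ k)); first by rewrite lerXn2r ?nnegrE// (le_trans Nq0).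
by apply: ler_weXn2l => //; rewrite -ltnS.
Qed.

End DefectProbability.

Section Representatives.
Import mathcomp.boot.fintype mathcomp.boot.finset.
Variable G : finZmodType.
Hypothesis oddG : odd #|G|.
Implicit Types x y : G.

(** One vertex per inversion class, the one enumerated first; the strict inequality excludes 0, and
    odd order ensures x != -x for the other elements. *)
Definition representatives : {set G} := [set x | (enum_rank x < enum_rank (- x))%N].

Lemma representatives_neq0 x : x \in representatives -> x != 0.
Proof. by rewrite inE; apply: contraTneq => ->; rewrite oppr0 ltnn. Qed.

Lemma oppr_eq x : (- x == x) = (x == 0).
Proof. by rewrite -(double_eq0 oddG x) mulr2n eq_sym -addr_eq0. Qed.

Lemma representativesN x : x != 0 -> (- x \in representatives) = (x \notin representatives).
Proof.
move=> x0; rewrite !inE opprK -leqNgt ltn_neqAle.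
suff -> : (enum_rank (- x) != enum_rank x :> nat) by [].
by apply: contraNN x0 => /eqP/val_inj/enum_rank_inj/eqP; rewrite oppr_eq.
Qed.

Lemma representatives_add_neq0 : {in representatives &, forall x y, x + y != 0}.
Proof.
move=> x y xR yR; apply/negP; rewrite addr_eq0 => /eqP xy.
have := representativesN (representatives_neq0 yR).
by rewrite -xy xR yR.
Qed.

Lemma sum_representatives (A : nmodType) (f : G -> A) : (forall x, f (- x) = f x) ->
  \sum_(x | x != 0) f x = (\sum_(x in representatives) f x) *+ 2.
Proof.
move=> fN; rewrite (bigID (fun x => x \in representatives))/= mulr2n; congr (_ + _).
  by apply: eq_bigl => x; case: (boolP (x \in _)) => [/representatives_neq0 ->|]; rewrite ?andbF.
rewrite (reindex_inj oppr_inj)/=.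
apply: eq_big => [x|x _]; last exact: fN.
rewrite oppr_eq0; case: eqVneq => [->|x0]/=; last by rewrite representativesN// negbK.
by rewrite inE oppr0 ltnn.
Qed.

Lemma card_representatives_le (R : realType) : #|representatives|%:R <= #|G|%:R / 2 :> R.
Proof.
have := sum_representatives (f := fun=> 1 : R) (fun=> erefl).
rewrite !sumr_const => H; rewrite ler_pdivlMr// mulr_natr -H ler_nat.
exact: max_card.
Qed.

End Representatives.

(** * Poisson approximation for a fixed group *)

Section FinitePoisson.
Import mathcomp.boot.fintype mathcomp.boot.finset.
Variables (R : realType) (G : finZmodType).
Hypothesis oddG : odd #|G|.
Variable q : R.
Hypothesis q01 : 0 <= q <= 1.
Local Notation prb := (@edge_prob R G q).
Local Notation N := (#|G|%:R : R).
Variable e : nat.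
Let M : R := 2 * N.
Let L : R := M ^+ e.+1 * q ^+ e.+2.
Let y : R := M * q.
Hypothesis y1 : 1 <= y.
Hypothesis qd1 : q ^+ e.+2 < 1.
Let mu : R := 2 * L / e.+2`!%:R.
Let err : R := defect_const R e * (L ^+ 2 / y + L / M).

Definition defect (x : G) (S : {set G}) := ~~ reach e.+2 S x.

Local Notation P := (event_prob prb defect).

Let p01 := @edge_prob01 R G q q01.

Let defect_antitone (j : G) (S T : {set G}) : S \subset T -> defect j T -> defect j S.
Proof. by move=> ST; apply: contraNN; exact: reachS. Qed.

(** [E1] bounds one defect probability and [U] the mean number of defect classes from above; [Q]
    bounds the sum of the pair probabilities, and [Lo] bounds the mean from below after summing over
    the N - 1 nonzero vertices and halving. *)
Let E1 := expR (- mu + err).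
Let U := N / 2 * E1.
Let Q := (N / 2) ^+ 2 * expR (- (2 * mu) + err).
Let Lo := (N - 1 - ((2 * e.+2) ^ e.+2 * e.+2)%:R * y ^+ e.+1) / 2 *
          expR (- (mu / (1 - q ^+ e.+2))).

Let P_ge0 x : 0 <= P x. Proof. by apply: Ex_ge0. Qed.

Let P_le x : x != 0 -> P x <= E1.
Proof.
move=> x0; apply: (@le_trans _ _ (expR (- (#|[set x]|%:R * mu) + err))).
  apply: le_trans (@defect_prob_le R G oddG q q01 e y1 [set x] _ _); last 2 first.
  - by rewrite cards1.
  - by move=> z z' /set1P -> /set1P ->; rewrite -mulr2n double_eq0.
  apply: le_Ex => // S; rewrite ler_nat; case: (boolP (defect x S)) => // xS.
  suff -> : [forall u in [set x], ~~ reach e.+2 S u] by [].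
  by apply/forall_inP => u /set1P ->.
by rewrite cards1 mul1r.
Qed.

Let P2_le x z : x \in representatives G -> z \in representatives G -> x != z ->
  event_prob2 prb defect x z <= expR (- (2 * mu) + err).
Proof.
move=> xR zR xz; apply: (@le_trans _ _ (expR (- (#|[set x; z]|%:R * mu) + err))).
  apply: le_trans (@defect_prob_le R G oddG q q01 e y1 [set x; z] _ _); last 2 first.
  - by rewrite cards2; case: (x != z).
  - have sub : {subset [set x; z] <= representatives G} by move=> u /set2P[] ->.
    by move=> u v /sub uR /sub vR; exact: representatives_add_neq0.
  apply: le_Ex => // S; rewrite -natrM mulnb ler_nat.
  case: (boolP (defect x S && defect z S)) => // /andP[xS zS].
  suff -> : [forall u in [set x; z], ~~ reach e.+2 S u] by [].
  by apply/forall_inP => u /set2P[] ->.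
by rewrite cards2 xz.
Qed.

Let mean := \sum_(x in representatives G) P x.

Let mean_le : mean <= U.
Proof.
apply: (@le_trans _ _ (\sum_(x in representatives G) E1)).
  by apply: ler_sum => x /(representatives_neq0) x0; exact: P_le.
by rewrite sumr_const -[leLHS]mulr_natl ler_wpM2r ?expR_ge0// card_representatives_le.
Qed.

Let mean_ge : Lo <= mean.
Proof.
have PN x : P (- x) = P x by apply: eq_Ex => S; rewrite /defect reachN.
have H := sum_representatives oddG PN.
rewrite -/mean in H.
have sum_ge : (N - 1 - ((2 * e.+2) ^ e.+2 * e.+2)%:R * y ^+ e.+1) *
     expR (- (mu / (1 - q ^+ e.+2))) <= \sum_(x | x != 0) P x.
  apply: (@le_trans _ _ (\sum_(x | x != 0) (1 - Ex prb (fun S => (short_reach e.+2 S x)%:R)) *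
      expR (- (mu / (1 - q ^+ e.+2))))); last first.
    by apply: ler_sum => x _; exact: (defect_prob_ge q01).
  rewrite -mulr_suml ler_wpM2r ?expR_ge0// sumrB; apply: lerB.
    rewrite sumr_const; have -> : #|[pred x : G | x != 0]| = #|G|.-1 by rewrite -(cardC1 (0 : G)).
    by rewrite -subn1 natrB//; apply/card_gt0P; exists 0.
  apply: le_trans _ (@sum_short_reach_le R G q q01 e y1).
  rewrite [leRHS](bigD1 0)//= lerDr.
  by apply: Ex_ge0.
rewrite H in sum_ge; rewrite /Lo mulrAC ler_pdivrMr// mulr_natr.
exact: sum_ge.
Qed.

(** The unknown mean lies between [Lo] and [U]. The bound vanishes in the limit where [U] and [Lo]
    tend to [lam], [E1] to 0 and [Q] to [lam ^+ 2]. *)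
Lemma finite_poisson_approximation (lam a : R) (A : pred nat) :
  0 < lam -> 0 <= a <= 1 ->
  (series (fun k => ((A k)%:R - a) * exp_coeff lam k) @ \oo --> 0)%classic ->
  `|Ex prb (fun S => (A (event_count (representatives G) defect S))%:R) - a| <=
  expR lam * (`|lam - U| + `|lam - Lo| + 2 * (2 * U * E1 + Q + lam ^+ 2 - 2 * lam * Lo)).
Proof.
move=> lam0 a01 cvgA.
have := @poisson_approximation R G prb G (representatives G) defect lam a A
  p01 defect_antitone lam0 a01 cvgA.
move=> /le_trans; apply.
rewrite -/mean ler_wpM2l ?expR_ge0//; apply: lerD.
  have := mean_le; have := mean_ge.
  have := ler_norm (lam - U); have := ler_norm (lam - Lo).
  have := ler_norm (- (lam - U)); have := ler_norm (- (lam - Lo)); rewrite !normrN.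
  have := normr_ge0 (lam - U); have := normr_ge0 (lam - Lo).
  by rewrite [in X in _ -> X]ler_norml; move=> *; apply/andP; split; lra.
rewrite ler_wpM2l//.
have sq : \sum_(x in representatives G) P x ^+ 2 <= U * E1.
  apply: (@le_trans _ _ (\sum_(x in representatives G) E1 ^+ 2)).
    apply: ler_sum => x /representatives_neq0 x0.
    by rewrite lerXn2r ?nnegrE ?P_le// expR_ge0.
  rewrite sumr_const -[leLHS]mulr_natl /U -mulrA -expr2.
  by rewrite ler_wpM2r ?exprn_ge0 ?expR_ge0// card_representatives_le.
have pairs : \sum_(x in representatives G) \sum_(z in representatives G | z != x)
    event_prob2 prb defect x z <= Q.
  set E2 := expR (- (2 * mu) + err).
  apply: (@le_trans _ _ (\sum_(x in representatives G) \sum_(z in representatives G) E2)).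
    apply: ler_sum => x xR; rewrite [leLHS]big_mkcondr/=; apply: ler_sum => z zR.
    by case: ifP => zx; [apply: P2_le => //; rewrite eq_sym|exact: expR_ge0].
  rewrite !sumr_const -!mulrnA -[leLHS]mulr_natl natrM /Q expr2 ler_wpM2r ?expR_ge0//.
  by rewrite ler_pM// card_representatives_le.
(* mean^2 >= 2 lam mean - lam^2 keeps the lower bound on mean usable even if Lo < 0 *)
have : 0 <= (lam - mean) ^+ 2 by exact: sqr_ge0.
have : lam * Lo <= lam * mean by rewrite ler_wpM2l ?mean_ge// ltW.
move: sq pairs.
set s1 := \sum_(x in _) _ ^+ 2; set s2 := \sum_(x in _) _ => h1 h2 h3 h4.
have -> : 2 * U * E1 + Q + lam ^+ 2 - 2 * lam * Lo = 2 * (U * E1) + Q + lam ^+ 2 - 2 * (lam * Lo) by ring.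
have : lam ^+ 2 - 2 * (lam * mean) + mean ^+ 2 = (lam - mean) ^+ 2 by ring.
lra.
Qed.

End FinitePoisson.

(** * Asymptotics at the critical edge probability *)

Section Asymptotics.
Local Open Scope classical_set_scope.
Variable R : realType.

Lemma exprn_cvg0 (u : nat -> R) k :
  (forall n, 0 <= u n) -> u n ^+ k.+1 @[n --> \oo] --> 0 -> u @ \oo --> 0.
Proof.
move=> u0 /cvgr0Pnorm_lt uk; apply/cvgr0Pnorm_lt => eps eps0.
near=> n.
have : `|u n ^+ k.+1| < eps ^+ k.+1 by near: n; apply: uk; exact: exprn_gt0.
rewrite (ger0_norm (u0 n)) (ger0_norm (exprn_ge0 _ (u0 n))).
by rewrite ltr_pXn2r// nnegrE// ltW.
Unshelve. all: by end_near. Qed.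

Lemma cvg_expr (u : nat -> R) (l : R) k : u @ \oo --> l -> u n ^+ k @[n --> \oo] --> l ^+ k.
Proof.
move=> ul; elim: k => [|k IH]; first by under eq_fun do rewrite expr0; exact: cvg_cst.
by under eq_fun do rewrite exprS; rewrite exprS; exact: cvgM.
Qed.

Lemma ler_expR_fact (x : R) k : 0 <= x -> x ^+ k.+1 / k.+1`!%:R <= expR x.
Proof. by move=> x0; apply: le_trans (expR_ge1Dxn k x0); rewrite lerDr. Qed.

Variables (N q : nat -> R) (e : nat) (c : R).
Hypothesis N1 : forall n, 1 <= N n.
Hypothesis Ninf : N @ \oo --> +oo.
Hypothesis q01 : forall n, 0 <= q n <= 1.

Let M n : R := 2 * N n.
Let L n : R := M n ^+ e.+1 * q n ^+ e.+2.
Let y n : R := M n * q n.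
Let mu n : R := 2 * L n / e.+2`!%:R.

Hypothesis mu_c : (mu n - ln (N n)) @[n --> \oo] --> c.

Let N0 n : 0 < N n. Proof. exact: lt_le_trans (N1 n). Qed.
Let M1 n : 1 <= M n. Proof. by rewrite /M; have := N1 n; lra. Qed.
Let M0 n : 0 < M n. Proof. exact: lt_le_trans (M1 n). Qed.
Let q0 n : 0 <= q n. Proof. by case/andP: (q01 n). Qed.
Let f0 : 0 < e.+2`!%:R :> R. Proof. by rewrite ltr0n fact_gt0. Qed.
Let L0 n : 0 <= L n. Proof. by rewrite mulr_ge0// exprn_ge0// ltW. Qed.
Let y0 n : 0 <= y n. Proof. by rewrite mulr_ge0// ltW. Qed.
Let mu0 n : 0 <= mu n.
Proof. by rewrite /mu divr_ge0 ?(ltW f0)//; apply: mulr_ge0. Qed.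

Let muE n : mu n = 2 / e.+2`!%:R * L n. Proof. by rewrite /mu mulrAC. Qed.
Let LE n : L n = e.+2`!%:R / 2 * mu n.
Proof. by rewrite muE; field; rewrite gt_eqF. Qed.

Lemma ln_cvgy : ln (N n) @[n --> \oo] --> +oo.
Proof.
apply/cvgryPge => A; near=> n; rewrite -(expRK A) ler_ln ?posrE ?expR_gt0//.
by near: n; exact: cvgry_ge.
Unshelve. all: by end_near. Qed.

Lemma mu_cvgy : mu @ \oo --> +oo.
Proof.
apply/cvgryPge => A; near=> n.
have -> : mu n = (mu n - ln (N n)) + ln (N n) by rewrite subrK.
have -> : A = (c - 1) + (A - c + 1) by ring.
apply: lerD; near: n; first by apply: (cvgr_ge c) => //; lra.
by apply: cvgry_ge; exact: ln_cvgy.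
Unshelve. all: by end_near. Qed.

Lemma invN_cvg0 : (N n)^-1 @[n --> \oo] --> 0.
Proof.
have Npos : \forall n \near \oo, 0 < N n by apply: nearW => n; exact: N0.
exact: (gtr0_cvgV0 Npos).2 Ninf.
Qed.

Let mu_gt0 : \forall n \near \oo, 0 < mu n.
Proof. by apply: cvgry_gt; exact: mu_cvgy. Qed.

Lemma expR_cvg (u : nat -> R) (l : R) : u @ \oo --> l -> expR (u n) @[n --> \oo] --> expR l.
Proof. by move=> ul; apply: continuous_cvg => //; exact: continuous_expR. Qed.

(** Since mu^(k+1) <= (k+1)! exp mu and exp mu = N exp(mu - ln N), the quotient is at most (k+1)!
    exp(mu - ln N) / mu, where the exponential converges and mu tends to infinity. *)
Lemma mu_exprn_div k : mu n ^+ k / N n @[n --> \oo] --> 0.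
Proof.
have bound : k.+1`!%:R * expR (mu n - ln (N n)) * (mu n)^-1 @[n --> \oo] --> 0.
  rewrite -(mulr0 (k.+1`!%:R * expR c)); apply: cvgM.
    by apply: cvgM; [exact: cvg_cst|exact: expR_cvg].
  exact: (gtr0_cvgV0 mu_gt0).2 mu_cvgy.
apply: (squeeze_cvgr _ (cvg_cst 0) bound); near=> n.
have mun : 0 < mu n by near: n.
apply/andP; split; first by rewrite divr_ge0 ?exprn_ge0// ltW.
rewrite ler_pdivlMr// mulrAC -exprSr expRB lnK; last exact: N0.
have := ler_expR_fact k (mu0 n); rewrite ler_pdivrMr ?ltr0n ?fact_gt0// => H.
by rewrite mulrA ler_wpM2r ?invr_ge0 ?(ltW (N0 n))// mulrC.
Unshelve. all: by end_near. Qed.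

Lemma L_exprn_div k : L n ^+ k / M n @[n --> \oo] --> 0.
Proof.
have -> : (fun n => L n ^+ k / M n) =
    (fun n => (e.+2`!%:R / 2) ^+ k / 2 * (mu n ^+ k / N n)).
  apply/funext => n; rewrite LE exprMn /M invfM; ring.
rewrite -(mulr0 ((e.+2`!%:R / 2) ^+ k / 2)); apply: cvgM; first exact: cvg_cst.
exact: mu_exprn_div.
Qed.

Let L_cvgy : L @ \oo --> +oo.
Proof.
apply/cvgryPge => A; near=> n; rewrite LE mulrC -ler_pdivrMr ?divr_gt0//.
by near: n; apply: cvgry_ge; exact: mu_cvgy.
Unshelve. all: by end_near. Qed.

Let L_gt0 : \forall n \near \oo, 0 < L n.
Proof. by apply: cvgry_gt; exact: L_cvgy. Qed.

Let y_pow n : y n ^+ e.+2 = L n * M n.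
Proof. by rewrite /y /L exprMn; move: (M n) => m; rewrite [m ^+ e.+2]exprS; ring. Qed.

Lemma y_ge1 : \forall n \near \oo, 1 <= y n.
Proof.
near=> n; rewrite -(@expr_ge1 _ e.+2)// y_pow.
have L1 : 1 <= L n by near: n; apply: cvgry_ge; exact: L_cvgy.
by rewrite -[leLHS]mulr1 ler_pM.
Unshelve. all: by end_near. Qed.

(** By y^d = L M, the d-th power of the quotient is a power of L divided by M. *)
Lemma L_exprn_div_y k : L n ^+ k.+1 / y n @[n --> \oo] --> 0.
Proof.
apply: (@exprn_cvg0 _ e.+1) => [n|]; first by rewrite divr_ge0 ?exprn_ge0.
apply: cvg_trans (L_exprn_div (k.+1 * e.+2).-1); apply: near_eq_cvg; near=> n.
have Ln : 0 < L n by near: n.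
have -> : (L n ^+ k.+1 / y n) ^+ e.+2 = L n ^+ (k.+1 * e.+2).-1 / M n.
  rewrite expr_div_n y_pow -exprM -[in LHS](prednK (_ : 0 < k.+1 * e.+2)%N)//.
  by rewrite exprS; field; rewrite !gt_eqF.
by [].
Unshelve. all: by end_near. Qed.

Lemma err_cvg0 : L n ^+ 2 / y n + L n / M n @[n --> \oo] --> 0.
Proof.
rewrite -[0]addr0; apply: cvgD; first exact: (L_exprn_div_y 1).
exact: (L_exprn_div 1).
Qed.

Let qd_le n : q n ^+ e.+2 <= L n / M n.
Proof.
rewrite ler_pdivlMr// /L mulrC ler_wpM2r ?exprn_ge0//.
by rewrite exprS ler_peMr ?(ltW (M0 n))// exprn_ege1.
Qed.

Lemma qd_cvg0 : q n ^+ e.+2 @[n --> \oo] --> 0.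
Proof.
apply: (squeeze_cvgr _ (cvg_cst 0) (L_exprn_div 1)); apply: nearW => n.
by rewrite exprn_ge0//= expr1 qd_le.
Qed.

Lemma qd_lt1 : \forall n \near \oo, q n ^+ e.+2 < 1.
Proof. by apply: cvgr_lt qd_cvg0 _ _. Qed.

Lemma mu_qd_cvg0 : mu n * q n ^+ e.+2 @[n --> \oo] --> 0.
Proof.
have bound : 2 / e.+2`!%:R * (L n ^+ 2 / M n) @[n --> \oo] --> 0.
  by rewrite -(mulr0 (2 / e.+2`!%:R)); apply: cvgM; [exact: cvg_cst|exact: L_exprn_div].
apply: (squeeze_cvgr _ (cvg_cst 0) bound); apply: nearW => n.
apply/andP; split; first by rewrite mulr_ge0// exprn_ge0.
rewrite muE -(mulrA (2 / _)); apply: ler_wpM2l; first by rewrite divr_ge0// ltW.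
by rewrite expr2 -(mulrA (L n) (L n)); apply: ler_wpM2l.
Qed.

Variable C : R.
Let err n := C * (L n ^+ 2 / y n + L n / M n).

Let C_err_cvg0 : err @ \oo --> 0.
Proof. by rewrite -(mulr0 C); apply: cvgM; [exact: cvg_cst|exact: err_cvg0]. Qed.

Lemma U_cvg : N n / 2 * expR (- mu n + err n) @[n --> \oo] --> expR (- c) / 2.
Proof.
have -> : (fun n => N n / 2 * expR (- mu n + err n)) =
    (fun n => expR (- (mu n - ln (N n)) + err n) / 2).
  apply/funext => n; rewrite opprB -addrA [in RHS]expRD lnK; last exact: N0.
  by rewrite mulrAC.
apply: cvgM; last exact: cvg_cst.
apply: expR_cvg; rewrite -[- c]addr0.
by apply: cvgD; [exact: cvgN|exact: C_err_cvg0].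
Qed.

Lemma E1_cvg : expR (- mu n + err n) @[n --> \oo] --> 0.
Proof.
have -> : (fun n => expR (- mu n + err n)) =
    (fun n => N n / 2 * expR (- mu n + err n) * (2 * (N n)^-1)).
  by apply/funext => n; field; rewrite gt_eqF.
rewrite -(mulr0 (expR (- c) / 2)); apply: cvgM; first exact: U_cvg.
by rewrite -(mulr0 2); apply: cvgM; [exact: cvg_cst|exact: invN_cvg0].
Qed.

Lemma Q_cvg : (N n / 2) ^+ 2 * expR (- (2 * mu n) + err n) @[n --> \oo] -->
  (expR (- c) / 2) ^+ 2.
Proof.
have -> : (fun n => (N n / 2) ^+ 2 * expR (- (2 * mu n) + err n)) =
    (fun n => (expR (- (mu n - ln (N n))) / 2) ^+ 2 * expR (err n)).
  apply/funext => n; rewrite opprB expRB lnK; last exact: N0.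
  rewrite expRD expRN expRM_natl; field; rewrite gt_eqF//=; exact: expR_gt0.
rewrite -[X in _ --> X]mulr1 -(expR0 R); apply: cvgM; last exact: expR_cvg.
apply: cvg_expr; apply: cvgM; last exact: cvg_cst.
by apply: expR_cvg; exact: cvgN.
Qed.

(** Two corrections must vanish: C y^(d-1) / N = 2 C L / y, from short walks, and mu / (1 - q^d) -
    mu = mu q^d / (1 - q^d), from Harris' product. *)
Lemma Lo_cvg : (N n - 1 - C * y n ^+ e.+1) / 2 * expR (- (mu n / (1 - q n ^+ e.+2)))
  @[n --> \oo] --> expR (- c) / 2.
Proof.
pose v n := - (mu n - ln (N n)) - mu n * q n ^+ e.+2 * (1 - q n ^+ e.+2)^-1.
have vc : v @ \oo --> - c.
  rewrite -[- c]subr0; apply: cvgB; first exact: cvgN.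
  rewrite -(mul0r (1 - 0)^-1); apply: cvgM; first exact: mu_qd_cvg0.
  apply: cvgV; first by rewrite subr0 oner_neq0.
  by apply: cvgB; [exact: cvg_cst|exact: qd_cvg0].
pose w n : R := (1 - (N n)^-1 - C * (2 * (L n ^+ 1 / y n))) / 2.
have wc : w @ \oo --> (2^-1 : R).
  rewrite /w -[X in _ --> X]mul1r; apply: cvgM; last exact: cvg_cst.
  rewrite -[X in _ --> X]subr0; apply: cvgB.
    by rewrite -[X in _ --> X]subr0; apply: cvgB; [exact: cvg_cst|exact: invN_cvg0].
  rewrite -(mulr0 C); apply: cvgM; first exact: cvg_cst.
  by rewrite -(mulr0 2); apply: cvgM; [exact: cvg_cst|exact: L_exprn_div_y].
rewrite mulrC; apply: cvg_trans (cvgM wc (expR_cvg vc)); apply: near_eq_cvg; near=> n.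
have yn : 1 <= y n by near: n; exact: y_ge1.
have qn : q n ^+ e.+2 < 1 by near: n; exact: qd_lt1.
have -> : y n ^+ e.+1 = N n * (2 * (L n ^+ 1 / y n)).
  apply: (@mulIf _ (y n)); first by rewrite gt_eqF// (lt_le_trans _ yn).
  rewrite -exprSr y_pow /M expr1; field.
  by rewrite gt_eqF// (lt_le_trans _ yn).
have -> : - (mu n / (1 - q n ^+ e.+2)) = v n - ln (N n).
  by rewrite /v; field; rewrite subr_eq0 eq_sym lt_eqF.
rewrite /= (expRB (v n) (ln (N n))) lnK; last exact: N0.
rewrite /w; field; rewrite gt_eqF//= gt_eqF//.
exact: (lt_le_trans _ yn).
Unshelve. all: by end_near. Qed.

End Asymptotics.

Section PoissonLimit.
Local Open Scope classical_set_scope.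
Variables (R : realType) (G : nat -> finZmodType) (q : nat -> R) (e : nat) (c : R).
Hypothesis oddG : forall n, odd #|G n|.
Hypothesis Ginf : #|G n| @[n --> \oo] --> \oo.
Hypothesis q01 : forall n, 0 <= q n <= 1.
Hypothesis qc : (2 ^+ e.+2 / (e.+2)`!%:R * (#|G n|%:R) ^+ e.+1 * (q n) ^+ e.+2 - ln (#|G n|%:R))
  @[n --> \oo] --> c.

Let lam : R := expR (- c) / 2.
Let N n : R := #|G n|%:R.

(** The error sequence is chosen before the event [A]; this uniformity is what convergence in total
    variation requires. *)
Lemma poisson_limit : exists2 err : nat -> R, err @ \oo --> 0 &
  \forall n \near \oo, forall (A : pred nat) (a : R), 0 <= a <= 1 ->
    series (fun k => ((A k)%:R - a) * exp_coeff lam k) @ \oo --> 0 ->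
  `|Ex (@edge_prob R (G n) (q n))
     (fun S => (A (event_count (representatives (G n)) (@defect (G n) e) S))%:R) - a| <= err n.
Proof.
have N1 n : 1 <= N n by rewrite ler1n; apply/card_gt0P; exists 0.
have Ninf : N @ \oo --> +oo by apply/cvgrnyP.
pose L n : R := (2 * N n) ^+ e.+1 * q n ^+ e.+2.
pose mu n : R := 2 * L n / e.+2`!%:R.
have mu_c : (mu n - ln (N n)) @[n --> \oo] --> c.
  rewrite (_ : (fun n => mu n - ln (N n)) = (fun n => 2 ^+ e.+2 / (e.+2)`!%:R *
    (#|G n|%:R) ^+ e.+1 * (q n) ^+ e.+2 - ln (#|G n|%:R))); first exact: qc.
  by apply/funext => n; rewrite /mu /L exprMn /N [2 ^+ e.+2]exprS; congr (_ - _); ring.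
pose C : R := defect_const R e.
pose C' : R := ((2 * e.+2) ^ e.+2 * e.+2)%:R.
have Uc := U_cvg N1 Ninf q01 mu_c C.
have Ec := E1_cvg N1 Ninf q01 mu_c C.
have Qc := Q_cvg N1 Ninf q01 mu_c C.
have Lc := Lo_cvg N1 Ninf q01 mu_c C'.
rewrite -/lam in Uc Qc Lc.
have lam0 : 0 < lam by rewrite divr_gt0// expR_gt0.
(* The error sequence is read off by unification from the bound for a fixed group; its convergence
   is proved afterwards. *)
eexists; last first.
  have y1 := y_ge1 N1 Ninf q01 mu_c.
  have qd1 := qd_lt1 N1 Ninf q01 mu_c.
  near=> n => A a a01 Aa.
  have y1n : 1 <= 2 * N n * q n by near: n.
  have qd1n : q n ^+ e.+2 < 1 by near: n.
  exact: (finite_poisson_approximation (oddG n) (q01 n) y1n qd1n lam0 a01 Aa).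
rewrite /=.
(* Zero is written as the value of the bound at the limits of its ingredients, so that convergence
   can be checked term by term. *)
have -> : 0 = expR lam * (`|lam - lam| + `|lam - lam| +
    2 * (2 * lam * 0 + lam ^+ 2 + lam ^+ 2 - 2 * lam * lam)) :> R.
  by rewrite subrr normr0; ring.
have d1 : `|lam - _ n| @[n --> \oo] --> `|lam - lam| := cvg_norm (cvgB (cvg_cst lam) Uc).
have d2 : `|lam - _ n| @[n --> \oo] --> `|lam - lam| := cvg_norm (cvgB (cvg_cst lam) Lc).
apply: cvgM; first exact: cvg_cst.
apply: cvgD; first by apply: cvgD; [exact: d1|exact: d2].
apply: cvgM; first exact: cvg_cst.
apply: cvgB; last by apply: cvgM; [exact: cvg_cst|exact: Lc].
apply: cvgD; last exact: cvg_cst.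
apply: cvgD; last exact: Qc.
by apply: cvgM; [apply: cvgM; [exact: cvg_cst|exact: Uc]|exact: Ec].
Unshelve. all: by end_near. Qed.

End PoissonLimit.

(** * Labelled Cayley graphs *)

Section RandomSetLaw.
Local Open Scope classical_set_scope.
Variables (R : realType) (G : finZmodType) (Lb : labelling R G).
Variable q : R.
Hypothesis q01 : 0 <= q <= 1.
Local Notation Pr := (label_prob Lb).
Local Notation prb := (@edge_prob R G q).
Implicit Types (S T : {set G}).

Lemma uniform_prob_Nyc : uniform_prob (@ltr01 R) `]-oo, q] = q%:E.
Proof.
rewrite /uniform_prob integral_uniform_pdf.
case/andP: q01 => q0 q1.
have -> : `]-oo, q] `&` `[0%R, 1%R] = `[0, q] :> set R.
  apply/seteqP; split => x /=; rewrite !in_itv/=; first by case=> xq /andP[-> _].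
  by move=> /andP[x0 xq]; rewrite x0 xq (le_trans xq).
rewrite (eq_integral (fun=> 1%E)); last first.
  move=> x; rewrite inE/= in_itv/= => /andP[x0 xq].
  by rewrite /uniform_pdf x0 (le_trans xq q1) subr0 invr1.
rewrite integral_cst//= mul1e lebesgue_measure_itv/= lte_fin sube0.
by case: ltP => // q0'; congr EFin; apply/le_anti/andP.
Qed.

Let below T (a : G) : set R := if a \in T then `]-oo, q] else ~` `]-oo, q].

Let measurable_below T a : measurable (below T a).
Proof. by rewrite /below; case: ifP => _; [|apply: measurableC]; exact: measurable_itv. Qed.

Let measurable_label a (B : set R) : measurable B -> measurable (label Lb a @^-1` B).
Proof. by move=> mB; rewrite -[X in measurable X]setTI; exact: measurable_funPT. Qed.

Let prob_below T a : a != 0 ->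
  Pr (label Lb a @^-1` below T a) = (if a \in T then q else 1 - q)%:E.
Proof.
move=> a0; have mI : measurable (`]-oo, q] : set R) by exact: measurable_itv.
have half : Pr (label Lb a @^-1` `]-oo, q]) = q%:E.
  by rewrite -uniform_prob_Nyc -(label_uniform Lb a0 mI).
rewrite /below; case: ifP => // _.
rewrite preimage_setC probability_setC; last exact: (measurable_label a mI).
by rewrite half EFinB.
Qed.

Let below_event T : [set w : label_space Lb | random_set q w = T] =
  if 0 \in T then set0 else \bigcap_(a in [set` [set~ 0]%SET]) (label Lb a @^-1` below T a).
Proof.
apply/seteqP; split => w /=.
  move=> wT; have memT a : (a \in T) = (a != 0) && (label Lb a w <= q).
    by rewrite -wT inE.
  rewrite memT eqxx/= => a /=; rewrite !inE => a0.
  by rewrite /below memT a0/=; case: ifP => /=; rewrite in_itv/= => ->.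
case: ifPn => //= T0 wT; apply/setP => a; rewrite inE.
case: eqVneq => [->|a0] /=; first by rewrite (negbTE T0).
have := wT a; rewrite /= !inE => /(_ a0); rewrite /below.
by case: ifP => _ /=; rewrite in_itv/= => // /negP/negbTE.
Qed.

Let measurable_random_set_eq T : measurable [set w : label_space Lb | random_set q w = T].
Proof.
rewrite below_event; case: ifP => // _.
apply: fin_bigcap_measurable => [|a _]; first exact: finite_finpred.
exact: measurable_label.
Qed.

Let prob_random_set_eq T :
  Pr [set w : label_space Lb | random_set q w = T] = (bernoulli_weight prb T)%:E.
Proof.
rewrite below_event; case: ifPn => T0.
  rewrite measure0 /bernoulli_weight (bigD1 0)//= T0 /edge_prob eqxx.
  by rewrite mul0r.
rewrite (@label_independent _ _ Lb _ (below T))//.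
rewrite (eq_bigr (fun a => (if a \in T then q else 1 - q)%:E)); last first.
  by move=> a; rewrite !inE => a0; exact: prob_below.
rewrite prodEFin; congr EFin; rewrite /bernoulli_weight [RHS](bigD1 0)//= (negbTE T0).
rewrite /edge_prob eqxx subr0 mul1r; apply: eq_big => a; first by rewrite !inE.
by rewrite !inE => a0; rewrite (negbTE a0).
Qed.

Let random_set_eventE (phi : pred {set G}) : [set w : label_space Lb | phi (random_set q w)] =
  \bigcup_(T in [set` phi]) [set w : label_space Lb | random_set q w = T].
Proof.
apply/seteqP; split => w /=; first by move=> ?; exists (random_set q w).
by case=> T /= ? ->.
Qed.

Lemma measurable_random_set (phi : pred {set G}) :
  measurable [set w : label_space Lb | phi (random_set q w)].
Proof.
rewrite random_set_eventE; apply: fin_bigcup_measurable => [|T _]; first exact: finite_finpred.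
exact: measurable_random_set_eq.
Qed.

(** The graph depends on the labels only through the finite set of those at most [q]; all
    probabilities on an arbitrary label space thus become finite sums over the product measure. *)
Lemma prob_random_set (phi : pred {set G}) :
  Pr [set w : label_space Lb | phi (random_set q w)] = (Ex prb (fun S => (phi S)%:R))%:E.
Proof.
rewrite random_set_eventE measure_fin_bigcup; last 3 first.
- exact: finite_finpred.
- by move=> T T' _ _ [w [/= <- <-]].
- by move=> T _; exact: measurable_random_set_eq.
rewrite -(bigfs _ (r := index_enum {set G})) ?index_enum_uniq//; last first.
  by move=> T _; rewrite mem_index_enum.
rewrite (eq_bigr (fun T => (bernoulli_weight prb T)%:E)); last first.
  by move=> T _; exact: prob_random_set_eq.
rewrite sumEFin; congr EFin; rewrite big_mkcond; apply: eq_bigr => T _.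
by case: (phi T); rewrite ?mulr1 ?mulr0.
Qed.

End RandomSetLaw.

(** * From graph distance to signed walks *)

Section Distance.
Import mathcomp.boot.fintype mathcomp.boot.finset.
Variables (R : realType) (G : finZmodType).
Hypothesis oddG : odd #|G|.
Local Notation letter := (G * bool)%type.
Implicit Types (x u v : G) (S : {set G}) (h : letter).

Lemma gdist_leP (V : finType) (r : rel V) (x y : V) d :
  reflect (exists p, [/\ path r x p, last x p = y & (size p <= d)%N])
    (gdist R r x y <= d%:R%:E)%E.
Proof.
apply: (iffP idP) => [|[p [xp py pd]]]; last first.
  apply: (@le_trans _ _ (size p)%:R%:E); last by rewrite lee_fin ler_nat.
  by apply: ereal_inf_lbound; exists p.
move=> le; apply: contrapT => nex; move: le; apply/negP; rewrite -ltNge.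
apply: (@lt_le_trans _ _ d.+1%:R%:E); first by rewrite lte_fin ltr_nat.
apply: le_ereal_inf_tmp => _ [p [xp py] <-]; rewrite lee_fin ler_nat ltnNge.
by apply/negP => pd; apply: nex; exists p.
Qed.

Lemma gdiam_leP (V : finType) (r : rel V) d :
  reflect (forall x y : V, (gdist R r x y <= d%:R%:E)%E) (gdiam R r <= d%:R%:E)%E.
Proof.
apply: (iffP idP) => [le x y|le].
  by apply: le_trans le; apply: ereal_sup_ubound; exists (x, y).
by apply: ge_ereal_sup => _ [[x y] _ <-]; exact: le.
Qed.

Definition inv_closure S : {set G} := S :|: [set - a | a in S].

Lemma inv_closureP S x : reflect (exists2 h, h.1 \in S & letter_val h = x) (x \in inv_closure S).
Proof.
rewrite in_setU; apply: (iffP orP) => [[xS|/imsetP[a aS ->]]|[[a b] /= aS <-]].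
- by exists (x, false).
- by exists (a, true).
- by case: b => /=; [right; apply/imsetP; exists a|left].
Qed.

Lemma reach00 S x : reach 0 S x = (x == 0).
Proof.
apply/existsP/eqP => [[w /andP[_ /eqP <-]]|->]; first by rewrite big_ord0.
exists [ffun=> (0, false)]; rewrite /walk big_ord0 eqxx andbT.
by apply/forallP => -[].
Qed.

Lemma reachSP d S x :
  reflect (exists2 h, h.1 \in 0 |: S & reach d S (x - letter_val h)) (reach d.+1 S x).
Proof.
apply: (iffP existsP) => [[w /andP[/forallP wS /eqP wx]]|[h hS /existsP[w /andP[/forallP wS /eqP wx]]]].
  exists (w ord0) => //; apply/existsP; exists [ffun i => w (lift ord0 i)].
  apply/andP; split; first by apply/forallP => i; rewrite ffunE.
  rewrite -wx big_ord_recl addrC addKr; apply/eqP.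
  by apply: eq_bigr => i _; rewrite ffunE.
exists [ffun i => if unlift ord0 i is Some j then w j else h].
apply/andP; split.
  by apply/forallP => i; rewrite ffunE; case: unliftP.
rewrite big_ord_recl ffunE unlift_none; apply/eqP.
rewrite (eq_bigr (fun i => letter_val (w i))); first by rewrite wx addrC subrK.
by move=> i _; rewrite ffunE liftK.
Qed.

Lemma reach_0 d S : reach d S 0.
Proof.
elim: d => [|d IH]; first by rewrite reach00.
by apply/reachSP; exists (0, false); rewrite ?setU11// subr0.
Qed.

Lemma path_reach d S u p : path (cayley (inv_closure S)) u p -> (size p <= d)%N ->
  reach d S (last u p - u).
Proof.
elim: p u d => [|v p IH] u d /=; first by rewrite subrr reach_0.
case: d => // d /andP[uv vp] pd; apply/reachSP.
have /inv_closureP[h hS hE] := uv.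
exists h; first by rewrite in_setU1 hS orbT.
by rewrite hE opprB addrA subrK; exact: IH.
Qed.

Lemma reach_path d S x u : reach d S x ->
  exists p, [/\ path (cayley (inv_closure S)) u p, last u p = u + x & (size p <= d)%N].
Proof.
elim: d x u => [|d IH] x u.
  by rewrite reach00 => /eqP ->; exists [::]; rewrite addr0.
case/reachSP => h; rewrite in_setU1 => /orP[/eqP h0|hS] /IH IHd.
  have [p [up px pd]] := IHd u; exists p; rewrite up px ltnW//; split => //.
  by rewrite (_ : letter_val h = 0) ?subr0// /letter_val h0 oppr0 if_same.
have [p [up px pd]] := IHd (u + letter_val h).
exists (u + letter_val h :: p); split => //=.
  rewrite up andbT; apply/inv_closureP; exists h => //.
  by rewrite addrC addKr.
by rewrite px addrACA subrr addr0.
Qed.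

Lemma gdist_reach d S x y :
  (gdist R (cayley (inv_closure S)) x y <= d%:R%:E)%E = reach d S (y - x).
Proof.
apply/gdist_leP/idP => [[p [xp <- pd]]|/(reach_path x)[p [xp px pd]]].
  exact: path_reach.
by exists p; rewrite px addrC subrK.
Qed.

Lemma gdiam_reach d S :
  (gdiam R (cayley (inv_closure S)) <= d%:R%:E)%E = [forall x, reach d S x].
Proof.
apply/gdiam_leP/forallP => [H x|H x y]; last by rewrite gdist_reach.
by have := H 0 x; rewrite gdist_reach subr0.
Qed.

Variable e : nat.

Lemma event_count_eq0 S :
  (event_count (representatives G) (@defect G e) S == 0%N) = [forall x, reach e.+2 S x].
Proof.
rewrite /event_count sum_nat_eq0; apply/forall_inP/forallP => [H x|H x _]; last first.
  by rewrite eqb0 negbK.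
have [->|x0] := eqVneq x 0; first exact: reach_0.
have [xR|xR] := boolP (x \in representatives G).
  by have := H x xR; rewrite eqb0 negbK.
rewrite -(representativesN oddG x0) in xR.
by have := H _ xR; rewrite eqb0 negbK reachN.
Qed.

Lemma card_defect_classes S :
  #|[set [set x; - x] | x in [set x : G | (x != 0) && defect e x S]]| =
  event_count (representatives G) (@defect G e) S.
Proof.
rewrite /event_count.
have -> : [set [set x; - x] | x in [set x : G | (x != 0) && defect e x S]] =
    [set [set x; - x] | x in [set x in representatives G | defect e x S]].
  apply/setP => C; apply/imsetP/imsetP => [[x]|[x]]; rewrite inE => /andP[].
    move=> x0 xd ->; have [xR|xR] := boolP (x \in representatives G).
      by exists x => //; rewrite inE xR.
    exists (- x); last by rewrite opprK setUC.
    by rewrite inE representativesN// xR /defect reachN.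
  by move=> xR xd ->; exists x => //; rewrite inE xd (representatives_neq0 xR).
rewrite card_in_imset; last first.
  move=> x y; rewrite inE => /andP[xR _]; rewrite inE => /andP[yR _] xy.
  have : x \in [set y; - y] by rewrite -xy set21.
  case/set2P => // xNy; have := representatives_add_neq0 oddG xR yR.
  by rewrite xNy addNr eqxx.
rewrite -sum1_card [LHS]big_mkcond [RHS]big_mkcond/=; apply: eq_bigr => x _.
by rewrite inE; case: (x \in representatives G) => //=; case: (defect e x S).
Qed.

End Distance.

Section DiameterLaw.
Local Open Scope classical_set_scope.
Variables (R : realType) (G : finZmodType) (Lb : labelling R G) (e : nat).
Hypothesis oddG : odd #|G|.
Implicit Types (q : R) (w : label_space Lb).

Local Notation defect_count := (event_count (representatives G) (@defect G e)).

Lemma diam_leE q w :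
  (gdiam R (Gamma q w) <= (e.+2)%:R%:E)%E = [forall x, reach e.+2 (random_set q w) x].
Proof. exact: gdiam_reach. Qed.

Lemma num_defect_classesE q w :
  num_defect_classes Lb e.+2 q w = defect_count (random_set q w).
Proof.
rewrite -card_defect_classes// /num_defect_classes /defect_classes.
rewrite (_ : finset _ = finset (fun x : G => (x != 0) && defect e x (random_set q w)))//.
apply/setP => x; rewrite !inE; congr (_ && _).
by rewrite ltNge /defect -[x in reach _ _ x]subr0 -(gdist_reach R).
Qed.

Lemma diam_le_event q : [set w : label_space Lb | (gdiam R (Gamma q w) <= (e.+2)%:R%:E)%E] =
  [set w : label_space Lb | [forall x, reach e.+2 (random_set q w) x]].
Proof. by apply/seteqP; split => w /=; rewrite diam_leE. Qed.

Lemma measurable_diam_le q : measurable [set w : label_space Lb | (gdiam R (Gamma q w) <= (e.+2)%:R%:E)%E].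
Proof.
rewrite diam_le_event.
exact: (@measurable_random_set R G Lb q (fun S => [forall x, reach e.+2 S x])).
Qed.

Lemma prob_diam_leE q : 0 <= q <= 1 ->
  prob_diam_le Lb e.+2 q = (Ex (@edge_prob R G q) (fun S => (defect_count S == 0%N)%:R))%:E.
Proof.
move=> q01; rewrite /prob_diam_le diam_le_event.
rewrite (@prob_random_set R G Lb q q01 (fun S => [forall x, reach e.+2 S x])).
by congr EFin; apply: eq_Ex => S; rewrite event_count_eq0.
Qed.

Lemma prob_num_defect_classes q (A : set nat) : 0 <= q <= 1 ->
  pushforward (label_prob Lb) (num_defect_classes Lb e.+2 q) A =
  (Ex (@edge_prob R G q) (fun S => (defect_count S \in A)%:R))%:E.
Proof.
move=> q01; rewrite /pushforward.
rewrite (_ : _ @^-1` A = [set w : label_space Lb | defect_count (random_set q w) \in A]).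
  exact: (@prob_random_set R G Lb q q01 (fun S => defect_count S \in A)).
by apply/seteqP; split => w /=; rewrite num_defect_classesE inE.
Qed.

Lemma random_setS q q' w : q <= q' -> (random_set q w \subset random_set q' w)%SET.
Proof.
move=> qq'; apply/fintype.subsetP => a; rewrite !inE => /andP[-> aq] /=.
exact: le_trans aq qq'.
Qed.

Lemma diam_le_mono q q' w : q <= q' -> (gdiam R (Gamma q w) <= (e.+2)%:R%:E)%E ->
  (gdiam R (Gamma q' w) <= (e.+2)%:R%:E)%E.
Proof.
rewrite !diam_leE => qq' /forallP H; apply/forallP => x.
by apply: reachS (H x); exact: random_setS.
Qed.

Lemma prob_diam_le_mono q q' : q <= q' ->
  (prob_diam_le Lb e.+2 q <= prob_diam_le Lb e.+2 q')%E.
Proof.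
move=> qq'; apply: le_measure; rewrite ?inE; [exact: measurable_diam_le..|].
by move=> w; exact: diam_le_mono.
Qed.

(** At q = 1 every nonzero element is chosen with probability 1, and each vertex is then reached in
    one step. *)
Lemma prob_diam_le1 : prob_diam_le Lb e.+2 1 = 1%E.
Proof.
rewrite prob_diam_leE ?lexx ?ler01//; congr EFin; apply/le_anti/andP; split.
  rewrite -[leRHS](Ex_cst (@edge_prob R G 1)); apply: le_Ex => [a|S].
    by apply: edge_prob01; rewrite lexx ler01.
  by rewrite lern1 leq_b1.
have one : Ex (@edge_prob R G 1) (incl R [set~ 0]%SET) = 1.
  by rewrite Ex_incl big1// => a; rewrite !inE /edge_prob => /negbTE ->.
rewrite -[leLHS]one.
apply: le_Ex => [a|S]; first by apply: edge_prob01; rewrite lexx ler01.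
rewrite /incl ler_nat; case: fintype.subsetP => //= sub.
rewrite event_count_eq0// lt0b; apply/forallP => x.
apply/reachSP; have [->|x0] := eqVneq x 0.
  by exists (0, false); rewrite ?setU11 ?subr0 ?reach_0.
exists (x, false); last by rewrite subrr reach_0.
by rewrite in_setU1 sub ?orbT// !inE.
Qed.

(** Labels are uniform only in law, so some may exceed 1 and leave even [Gamma 1 w] with diameter
    above d. The infimum is then over the empty set and equals 0 by convention, which accounts for
    the second event, of probability 0. Elsewhere the infimum is attained, because the graph is a
    right-continuous step function of q. *)
Lemma hitting_time_event q : 0 <= q < 1 ->
  [set w | hitting_time Lb e.+2 w <= q] =
  [set w | (gdiam R (Gamma q w) <= (e.+2)%:R%:E)%E] `|`
  ~` [set w : label_space Lb | (gdiam R (Gamma 1 w) <= (e.+2)%:R%:E)%E].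
Proof.
move=> /andP[q0 q1]; apply/seteqP; split => w /=; last first.
  rewrite /hitting_time => -[qw|nw].
    apply: ge_inf; last by rewrite /= q0 (ltW q1).
    by exists 0 => r /= [/andP[]].
  rewrite (_ : mkset _ = set0) ?inf0//.
  apply/seteqP; split => r //= [/andP[r0 r1] rw]; apply: nw.
  exact: diam_le_mono rw.
move=> hit; have [w1|] := boolP (gdiam R (Gamma 1 w) <= (e.+2)%:R%:E)%E; last by move=> /negP; right.
left; apply: contrapT => nq.
(* The next label above q, capped at 1. The graph does not change on [q, m), so if it fails at q it
   still fails at the midpoint q', and the hitting time exceeds q. *)
pose m := \big[Order.min/1]_(a : G | q < label Lb a w) label Lb a w.
have qm : q < m by rewrite /m; elim/big_ind: _ => // x y; rewrite lt_min => -> ->.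
have m1 : m <= 1.
  by rewrite /m; elim/big_rec: _ => // a x _ x1; rewrite ge_min x1 orbT.
have ma a : q < label Lb a w -> m <= label Lb a w.
  by move=> qa; rewrite /m (bigD1 a)//= ge_min lexx.
pose q' := (q + m) / 2.
have qq' : q < q' by rewrite /q' midf_lt.
have q'm : q' < m by rewrite /q' midf_lt.
have same : random_set q' w = random_set q w.
  apply/setP => a; rewrite !inE; congr (_ && _); apply/idP/idP => [aq'|aq]; last exact: le_trans aq (ltW qq').
  by rewrite leNgt; apply/negP => /ma; rewrite leNgt (le_lt_trans aq' q'm).
have nq' : ~ (gdiam R (Gamma q' w) <= (e.+2)%:R%:E)%E by rewrite diam_leE same -diam_leE.
suff : q' <= hitting_time Lb e.+2 w by rewrite leNgt (le_lt_trans hit qq').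
apply: lb_le_inf; first by exists 1; rewrite /= lexx ler01.
move=> r /= [/andP[r0 r1] rw]; rewrite leNgt; apply/negP => /ltW rq'.
by apply: nq'; exact: diam_le_mono rw.
Qed.

Lemma prob_hitting_time_le q : 0 <= q < 1 ->
  label_prob Lb [set w | hitting_time Lb e.+2 w <= q] = prob_diam_le Lb e.+2 q.
Proof.
move=> q01; rewrite hitting_time_event//.
have m1 := measurable_diam_le 1.
apply: measureU0; [exact: measurable_diam_le|exact: measurableC|].
have := probability_setC (label_prob Lb) m1.
by rewrite -/(prob_diam_le Lb e.+2 1) prob_diam_le1 subee// => ->.
Qed.

End DiameterLaw.

(** * The Poisson law as a weighted series *)

Section PoissonMeasure.
Local Open Scope classical_set_scope.
Variables (R : realType) (lam : R).
Hypothesis lam0 : 0 < lam.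

Lemma poisson_pmf_exp_coeff k : poisson_pmf lam k = expR (- lam) * exp_coeff lam k.
Proof. by rewrite /poisson_pmf lam0 exp_coeffE [RHS]mulrC; congr (_ * _); rewrite mulrC. Qed.

(** Supplies the centring condition of the Stein equation: with weights lam^k / k!, the indicator of
    [A] and the constant [a] both sum to a exp lam. *)
Lemma poisson_prob_series (A : set nat) : exists2 a : R, poisson_prob lam 0%N A = a%:E &
  0 <= a <= 1 /\ series (fun k => ((k \in A)%:R - a) * exp_coeff lam k) @ \oo --> 0.
Proof.
have mA : measurable A by [].
have fA : poisson_prob lam 0%N A \is a fin_num by exact: fin_num_measure.
exists (fine (poisson_prob lam 0%N A)); first by rewrite fineK.
split.
  by rewrite -!lee_fin fineK// measure_ge0 probability_le1.
set a := fine _.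
have pmf0 n : (0 <= (poisson_pmf lam n)%:E)%E by rewrite lee_fin poisson_pmf_ge0.
have partial : \sum_(0 <= k < n | k \in A) (poisson_pmf lam k)%:E @[n --> \oo] --> a%:E.
  have AE : [set k | k \in A] = A by apply/seteqP; split => k /=; rewrite inE.
  rewrite /a fineK// /poisson_prob lam0 -[X in esum X _]AE -nneseries_esum//.
  by apply: is_cvg_nneseries_cond => n _ _; exact: pmf0.
have real_partial : \sum_(0 <= k < n | k \in A) poisson_pmf lam k @[n --> \oo] --> a.
  move: partial => /fine_cvgP[_]; apply: cvg_trans; apply: near_eq_cvg; apply: nearW => n /=.
  by rewrite sumEFin.
have -> : series (fun k => ((k \in A)%:R - a) * exp_coeff lam k) =
   (fun n => expR lam * \sum_(0 <= k < n | k \in A) poisson_pmf lam k -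
      a * series (exp_coeff lam) n).
  apply/funext => n; rewrite /series /= !mulr_sumr [X in _ = X - _]big_mkcond -sumrB.
  apply: eq_bigr => k _; rewrite poisson_pmf_exp_coeff mulrA -expRD subrr expR0 mul1r.
  by case: (k \in A); rewrite ?mul1r ?mul0r mulrBl ?mul1r ?mul0r.
rewrite -[X in _ --> X](subrr (a * expR lam)); apply: cvgB.
  by rewrite mulrC; apply: cvgM; [exact: cvg_cst|exact: real_partial].
by apply: cvgM; [exact: cvg_cst|exact: is_cvg_series_exp_coeff].
Qed.

Lemma poisson_prob0 : poisson_prob lam 0%N [set 0%N] = (expR (- lam))%:E.
Proof.
rewrite /poisson_prob lam0 esum_set1 ?lee_fin ?poisson_pmf_ge0//.
by rewrite poisson_pmf_exp_coeff exp_coeffE /= expr0 fact0 invr1 !mulr1.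
Qed.

End PoissonMeasure.

(** * Limit laws and sharp threshold *)

Section Limits.
Local Open Scope classical_set_scope.
Variables (R : realType) (e : nat) (G : nat -> finZmodType).
Variable Lb : forall n, labelling R (G n).
Hypothesis oddG : forall n, odd #|G n|.
Hypothesis Ginf : #|G n| @[n --> \oo] --> \oo.

Let scale n : R := 2 ^+ e.+2 / (e.+2)`!%:R * #|G n|%:R ^+ e.+1.

Lemma dTV_diam_cvg (c : R) (q : nat -> R) : (forall n, 0 <= q n <= 1) ->
  scale n * q n ^+ e.+2 - ln #|G n|%:R @[n --> \oo] --> c ->
  dTV (pushforward (label_prob (Lb n)) (num_defect_classes (Lb n) e.+2 (q n)))
    (poisson_prob (expR (- c) / 2) 0%N) @[n --> \oo] --> 0%E /\
  prob_diam_le (Lb n) e.+2 (q n) @[n --> \oo] --> (expR (- (expR (- c) / 2)))%:E.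
Proof.
move=> q01 qc; set lam := expR (- c) / 2.
have lam0 : 0 < lam by rewrite divr_gt0// expR_gt0.
have [err err0 bound] := poisson_limit oddG Ginf q01 qc.
have err0E : (err n)%:E @[n --> \oo] --> 0%:E by apply: cvg_EFin => //; exact: nearW.
have close : \forall n \near \oo, forall A : set nat,
    (`|pushforward (label_prob (Lb n)) (num_defect_classes (Lb n) e.+2 (q n)) A -
       poisson_prob lam 0%N A| <= (err n)%:E)%E.
  near=> n => A; rewrite prob_num_defect_classes//.
  have [a -> [a01 sa]] := poisson_prob_series lam0 A.
  rewrite -EFinB abse_EFin lee_fin.
  have nb : forall (A : pred nat) (a : R), 0 <= a <= 1 ->
    series (fun k => ((A k)%:R - a) * exp_coeff (expR (- c) / 2) k) @ \oo --> 0 ->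
    `|Ex (@edge_prob R (G n) (q n))
     (fun S => (A (event_count (representatives (G n)) (@defect (G n) e) S))%:R) - a| <= err n.
    by near: n.
  exact: (nb (fun k => k \in A) a a01 sa).
split.
  apply: (squeeze_cvge _ (cvg_cst 0%E) err0E); near=> n.
  have cn : forall A : set nat,
    (`|pushforward (label_prob (Lb n)) (num_defect_classes (Lb n) e.+2 (q n)) A -
       poisson_prob lam 0%N A| <= (err n)%:E)%E by near: n.
  apply/andP; split; last by apply: ge_ereal_sup => _ [A _ <-]; exact: cn.
  apply: le_trans (ereal_sup_ubound _); last by exists set0; [exact: measurable0|reflexivity].
  exact: abse_ge0.
apply/fine_cvgP; split.
  by apply: nearW => n; rewrite prob_diam_leE.
have up : expR (- lam) + err n @[n --> \oo] --> expR (- lam).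
  by rewrite -[X in _ --> X]addr0; apply: cvgD; [exact: cvg_cst|exact: err0].
have lo : expR (- lam) - err n @[n --> \oo] --> expR (- lam).
  by rewrite -[X in _ --> X]subr0; apply: cvgB; [exact: cvg_cst|exact: err0].
apply: (squeeze_cvgr _ lo up); near=> n.
rewrite -ler_distl -lee_fin.
have cn : forall A : set nat,
    (`|pushforward (label_prob (Lb n)) (num_defect_classes (Lb n) e.+2 (q n)) A -
       poisson_prob lam 0%N A| <= (err n)%:E)%E by near: n.
apply: le_trans (cn [set 0%N]); rewrite (poisson_prob0 lam0) prob_num_defect_classes//.
rewrite /comp prob_diam_leE//= lee_fin.
rewrite (eq_Ex _ (g := fun S => (event_count (representatives (G n)) (@defect (G n) e) S \in [set 0%N])%:R))//.
move=> S; congr (_%:R); congr nat_of_bool; apply/idP/idP; first by move=> /eqP ->; rewrite inE.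
by rewrite inE => /= ->.
Unshelve. all: by end_near. Qed.

Let N_cvgy : (#|G n|%:R : R) @[n --> \oo] --> +oo.
Proof. exact/cvgrnyP. Qed.

Let N_gt0 n : 0 < #|G n|%:R :> R.
Proof. by rewrite ltr0n; apply/card_gt0P; exists 0. Qed.

Let lnN_cvgy : ln (#|G n|%:R : R) @[n --> \oo] --> +oo.
Proof. by apply: ln_cvgy => // n; rewrite ler1n -(ltr0n R). Qed.

Let scale_gt0 n : 0 < scale n.
Proof. by rewrite mulr_gt0 ?exprn_gt0// divr_gt0 ?exprn_gt0// ltr0n fact_gt0. Qed.

(** An explicit critical sequence at level [c]. The hitting time is compared with it directly, and
    the sharp threshold follows by monotonicity in q from such sequences at suitable levels. *)
Lemma critical_edge_prob (c : R) : exists q : nat -> R,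
  [/\ forall n, 0 <= q n < 1,
     \forall n \near \oo, scale n * q n ^+ e.+2 = ln #|G n|%:R + c &
     prob_diam_le (Lb n) e.+2 (q n) @[n --> \oo] --> (expR (- (expR (- c) / 2)))%:E].
Proof.
pose t n := (ln #|G n|%:R + c) / scale n.
(* The d-th root is a probability below 1 only when [t n] lies in (0, 1), which holds eventually; 0
   is a default for the other indices. *)
pose q n := if 0 < t n < 1 then t n `^ (e.+2%:R^-1) else 0.
have q_root n : 0 < t n < 1 -> q n ^+ e.+2 = t n.
  move=> t01; rewrite /q t01; case/andP: t01 => t0 _.
  by rewrite -powR_mulrn ?powR_ge0// -powRrM mulVf ?powRr1 ?ltW// pnatr_eq0.
have q_ge0 n : 0 <= q n by rewrite /q; case: ifP => // _; exact: powR_ge0.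
have q01 n : 0 <= q n < 1.
  rewrite q_ge0 /=; have [t01|t01] := boolP (0 < t n < 1).
    have : q n ^+ e.+2 < 1 ^+ e.+2 by rewrite q_root// expr1n; case/andP: t01.
    by rewrite ltr_pXn2r// nnegrE.
  by rewrite /q (negbTE t01).
have t01 : \forall n \near \oo, 0 < t n < 1.
  pose k : R := 2 ^+ e.+2 / e.+2`!%:R.
  have k0 : 0 < k by rewrite divr_gt0 ?exprn_gt0// ltr0n fact_gt0.
  near=> n; have lnc : `|c| < ln (#|G n|%:R : R) by near: n; exact: cvgry_gt.
  (* For s = ln N above |c| and at least 4 / k, one has s + c < 2 s <= k s^2 / 2 <= k N <=
     [scale n], hence t < 1. *)
  have lnk : 4 / k <= ln (#|G n|%:R : R) by near: n; exact: cvgry_ge.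
  have c1 : c <= `|c| by exact: ler_norm.
  have c2 : - c <= `|c| by rewrite -normrN; exact: ler_norm.
  rewrite /t ltr_pdivrMr// mul1r; apply/andP; split.
    by rewrite divr_gt0//; lra.
  have s0 : 0 <= ln (#|G n|%:R : R) by apply: le_trans (ltW lnc).
  have := expR_ge1Dxn 1 s0; rewrite lnK; last by rewrite posrE.
  rewrite ler_pdivrMr// mulrC in lnk; move: (ln _) lnc lnk s0 => s lnc lnk s0 Ns.
  have sN : s ^+ 2 / 2 <= #|G n|%:R by apply: le_trans _ Ns; rewrite lerDr.
  have kN : k * #|G n|%:R <= scale n.
    by rewrite /scale ler_wpM2l ?(ltW k0)// exprS ler_peMr ?exprn_ege1 ?(ltW (N_gt0 n))// ler1n -(ltr0n R).
  apply: lt_le_trans kN; apply: lt_le_trans (ler_wpM2l (ltW k0) sN).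
  have : 4 * s <= k * s * s by rewrite ler_wpM2r.
  rewrite expr2; move: c1 lnc; move: (k * s * s) (mulrA k s s) => u us.
  have -> : k * (s * s / 2) = u / 2 by rewrite mulrA us.
  lra.
have scaleE : \forall n \near \oo, scale n * q n ^+ e.+2 = ln #|G n|%:R + c.
  near=> n; have tn : 0 < t n < 1 by near: n.
  by rewrite q_root// /t mulrC divfK// gt_eqF.
exists q; split => //; apply: (dTV_diam_cvg _ _).2.
  by move=> n; have /andP[-> /ltW ->] := q01 n.
have cst_cvg : (fun=> c) @ \oo --> c by exact: cvg_cst.
apply: cvg_trans cst_cvg; apply: near_eq_cvg; near=> n.
have -> : scale n * q n ^+ e.+2 = ln #|G n|%:R + c by near: n.
by rewrite addrAC subrr add0r.
Unshelve. all: by end_near. Qed.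

Lemma hitting_time_ge0 n w : 0 <= hitting_time (Lb n) e.+2 w.
Proof.
rewrite /hitting_time; set A := mkset _.
have [->|/set0P A0] := eqVneq A set0; first by rewrite inf0.
by apply: lb_le_inf => // r [/andP[]].
Qed.

Lemma hitting_time_cvg (c : R) :
  label_prob (Lb n) [set w | scale n * hitting_time (Lb n) e.+2 w ^+ e.+2 - ln #|G n|%:R <= c]
    @[n --> \oo] --> (expR (- (expR (- c) / 2)))%:E.
Proof.
have [q [q01 scaleE cvgq]] := critical_edge_prob c.
apply: cvg_trans cvgq; apply: near_eq_cvg; near=> n.
have sE : scale n * q n ^+ e.+2 = ln #|G n|%:R + c by near: n.
have /andP[q0 _] := q01 n.
rewrite -(prob_hitting_time_le (Lb n) e (oddG n) (q01 n)); congr (label_prob _ _).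
apply/seteqP; split => w /=; rewrite lerBlDl -sE ler_pM2l// ler_pXn2r// nnegrE//;
  exact: hitting_time_ge0.
Unshelve. all: by end_near. Qed.

Lemma prob_diam_cvg1 (q : nat -> R) : (forall n, 0 <= q n <= 1) ->
  (forall c, \forall n \near \oo, ln #|G n|%:R + c <= scale n * q n ^+ e.+2) ->
  prob_diam_le (Lb n) e.+2 (q n) @[n --> \oo] --> 1%E.
Proof.
move=> q01 large.
have fin n : prob_diam_le (Lb n) e.+2 (q n) = (fine (prob_diam_le (Lb n) e.+2 (q n)))%:E.
  by rewrite prob_diam_leE.
apply/fine_cvgP; split; first by apply: nearW => n; rewrite fin.
apply/cvgrPdist_le => eps eps0.
(* At this level the limiting probability is exp(- eps / 2) > 1 - eps. *)
pose c := - ln eps.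
have [qc [qc01 scaleE cvgq]] := critical_edge_prob c.
have /fine_cvgP[_ cvgf] := cvgq.
have lim_gt : 1 - eps < expR (- (expR (- c) / 2)).
  rewrite /c opprK lnK ?posrE//; apply: lt_le_trans (expR_ge1Dx _).
  by rewrite ltrD2l ltrN2 ltr_pdivrMr// ltr_pMr// ltr1n.
near=> n.
have p1 : fine (prob_diam_le (Lb n) e.+2 (q n)) <= 1.
  by rewrite -lee_fin -fin /prob_diam_le probability_le1//; exact: measurable_diam_le.
rewrite /= ger0_norm ?subr_ge0// lerBlDr -lerBlDl.
have qn : qc n <= q n.
  have /andP[qc0 _] := qc01 n; have /andP[q0 _] := q01 n.
  have : scale n * qc n ^+ e.+2 <= scale n * q n ^+ e.+2.
    have -> : scale n * qc n ^+ e.+2 = ln #|G n|%:R + c by near: n.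
    by near: n; exact: large.
  by rewrite ler_pM2l// ler_pXn2r// nnegrE.
have pq := @prob_diam_le_mono R (G n) (Lb n) e _ _ qn.
rewrite fin in pq.
have qcn : 0 <= qc n <= 1 by have /andP[-> /ltW ->] := qc01 n.
have fc : prob_diam_le (Lb n) e.+2 (qc n) = (fine (prob_diam_le (Lb n) e.+2 (qc n)))%:E.
  by rewrite prob_diam_leE.
rewrite fc lee_fin in pq; apply: le_trans _ pq; apply: ltW.
by near: n; exact: cvgr_gt cvgf _ lim_gt.
Unshelve. all: by end_near. Qed.

Lemma prob_diam_cvg0 (q : nat -> R) : (forall n, 0 <= q n <= 1) ->
  (forall c, \forall n \near \oo, scale n * q n ^+ e.+2 <= ln #|G n|%:R + c) ->
  prob_diam_le (Lb n) e.+2 (q n) @[n --> \oo] --> 0%E.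
Proof.
move=> q01 small.
have fin n : prob_diam_le (Lb n) e.+2 (q n) = (fine (prob_diam_le (Lb n) e.+2 (q n)))%:E.
  by rewrite prob_diam_leE.
apply/fine_cvgP; split; first by apply: nearW => n; rewrite fin.
apply/cvgrPdist_le => eps eps0.
(* At this level the limiting probability is exp(- 1 / eps), which is below eps because exp(1 / eps)
   > 1 / eps. *)
pose c := - ln (2 / eps).
have [qc [qc01 scaleE cvgq]] := critical_edge_prob c.
have /fine_cvgP[_ cvgf] := cvgq.
have lim_lt : expR (- (expR (- c) / 2)) < eps.
  have e2 : 0 < 2 / eps by rewrite divr_gt0.
  rewrite /c opprK lnK ?posrE// mulrAC divff// mul1r expRN.
  rewrite -[ltRHS]invrK ltf_pV2 ?posrE ?invr_gt0 ?expR_gt0//.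
  by apply: lt_le_trans (expR_ge1Dx _); rewrite ltrDr.
near=> n.
have p0 : 0 <= fine (prob_diam_le (Lb n) e.+2 (q n)).
  by rewrite -lee_fin -fin /prob_diam_le.
rewrite /= sub0r normrN ger0_norm//.
have qn : q n <= qc n.
  have /andP[qc0 _] := qc01 n; have /andP[q0 _] := q01 n.
  have : scale n * q n ^+ e.+2 <= scale n * qc n ^+ e.+2.
    have -> : scale n * qc n ^+ e.+2 = ln #|G n|%:R + c by near: n.
    by near: n; exact: small.
  by rewrite ler_pM2l// ler_pXn2r// nnegrE.
have pq := @prob_diam_le_mono R (G n) (Lb n) e _ _ qn.
rewrite fin in pq.
have qcn : 0 <= qc n <= 1 by have /andP[-> /ltW ->] := qc01 n.
have fc : prob_diam_le (Lb n) e.+2 (qc n) = (fine (prob_diam_le (Lb n) e.+2 (qc n)))%:E.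
  by rewrite prob_diam_leE.
rewrite fc lee_fin in pq; apply: le_trans pq _; apply: ltW.
by near: n; exact: cvgr_lt cvgf _ lim_lt.
Unshelve. all: by end_near. Qed.

Let scale_threshold n (s : R) :
  scale n * (s * ((e.+2)`!%:R / 2 ^+ e.+2 * (ln #|G n|%:R / #|G n|%:R ^+ e.+1))) =
  s * ln #|G n|%:R.
Proof.
have f0 : e.+2`!%:R != 0 :> R by rewrite pnatr_eq0 -lt0n fact_gt0.
have N0 : #|G n|%:R ^+ e.+1 != 0 :> R by rewrite expf_neq0// gt_eqF.
have t0 : 2 ^+ e.+2 != 0 :> R by rewrite expf_neq0.
rewrite /scale; move: (ln _) (_`!%:R) (_ ^+ e.+1) (2 ^+ e.+2) f0 N0 t0 => l f m t f0 m0 t0.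
by field; rewrite f0 m0 t0.
Qed.

Let lnN_large (eps c : R) : 0 < eps -> \forall n \near \oo, c <= eps * ln (#|G n|%:R : R).
Proof.
move=> eps0; near=> n; rewrite mulrC -ler_pdivrMr//.
by near: n; exact: cvgry_ge.
Unshelve. all: by end_near. Qed.
Lemma prob_diam_above (eps : R) (q : nat -> R) : 0 < eps -> (forall n, 0 <= q n <= 1) ->
  (\forall n \near \oo, (1 + eps) * ((e.+2)`!%:R / 2 ^+ e.+2 *
     (ln #|G n|%:R / #|G n|%:R ^+ e.+1)) <= q n ^+ e.+2) ->
  prob_diam_le (Lb n) e.+2 (q n) @[n --> \oo] --> 1%E.
Proof.
move=> eps0 q01 large; apply: prob_diam_cvg1 => // c; near=> n.
have le_q : (1 + eps) * ((e.+2)`!%:R / 2 ^+ e.+2 *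
     (ln #|G n|%:R / #|G n|%:R ^+ e.+1)) <= q n ^+ e.+2 by near: n.
have := ler_wpM2l (ltW (scale_gt0 n)) le_q; rewrite scale_threshold.
apply: le_trans; rewrite mulrDl mul1r lerD2l.
by near: n; exact: lnN_large.
Unshelve. all: by end_near. Qed.

Lemma prob_diam_below (eps : R) (q : nat -> R) : 0 < eps -> (forall n, 0 <= q n <= 1) ->
  (\forall n \near \oo, q n ^+ e.+2 <= (1 - eps) * ((e.+2)`!%:R / 2 ^+ e.+2 *
     (ln #|G n|%:R / #|G n|%:R ^+ e.+1))) ->
  prob_diam_le (Lb n) e.+2 (q n) @[n --> \oo] --> 0%E.
Proof.
move=> eps0 q01 small; apply: prob_diam_cvg0 => // c; near=> n.
have q_le : q n ^+ e.+2 <= (1 - eps) * ((e.+2)`!%:R / 2 ^+ e.+2 *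
     (ln #|G n|%:R / #|G n|%:R ^+ e.+1)) by near: n.
have := ler_wpM2l (ltW (scale_gt0 n)) q_le; rewrite scale_threshold.
move=> /le_trans; apply; rewrite mulrBl mul1r lerD2l lerNl.
by near: n; exact: lnN_large.
Unshelve. all: by end_near. Qed.

End Limits.

Local Open Scope classical_set_scope.
Local Open Scope ring_scope.

Theorem corollary1p4 (R : realType) (d : nat) (hd : (2 <= d)%N) :
  (forall (G : nat -> finZmodType) (M : forall n, labelling R (G n)),
    (forall n, odd #|G n|) ->
    #|G n| @[n --> \oo] --> \oo ->
    (forall (disp : measure_display) (Omega : measurableType disp)
        (P : probability Omega R) (Gum : {RV P >-> R}),
      (forall c : R, cdf Gum c = (expR (- expR (- c)))%:E) ->
      cvg_in_distribution (fun n => label_prob (M n))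
        (fun n w => 2 ^+ d / (d`!)%:R * (#|G n|%:R) ^+ d.-1
                      * (hitting_time (M n) d w) ^+ d - ln (#|G n|%:R))
        P (fun w => Gum w - ln 2)) /\
    (forall (c : R) (q : nat -> R),
      (forall n, 0 <= q n <= 1) ->
      (2 ^+ d / (d`!)%:R * (#|G n|%:R) ^+ d.-1 * (q n) ^+ d - ln (#|G n|%:R))
        @[n --> \oo] --> c ->
      (* the second argument of poisson_prob is a dummy *)
      dTV (pushforward (label_prob (M n)) (num_defect_classes (M n) d (q n)))
          (poisson_prob (expR (- c) / 2) 0%N) @[n --> \oo] --> 0%E /\
      prob_diam_le (M n) d (q n) @[n --> \oo] -->
        (expR (- (expR (- c) / 2)))%:E)) /\
  diam_sharp_threshold d
    (fun N : nat => (d`!)%:R / 2 ^+ d * (ln (N%:R) / N%:R ^+ d.-1) : R).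
Proof.
case: d hd => [//|[//|e]] _; split=> [G M oddG Ginf|eps G M q eps0 oddG Ginf q01]; split.
- move=> disp Omega P Gum GumE F c _; rewrite {}/F.
  have -> : P [set w | Gum w - ln 2 <= c] = (expR (- (expR (- c) / 2)))%:E.
    (* Halving the Poisson mean amounts to shifting c by ln 2, the shift in the Gumbel limit. *)
    have -> : expR (- c) / 2 = expR (- (c + ln 2)).
      by rewrite opprD expRD [expR (- ln 2)]expRN lnK// posrE.
    rewrite -GumE /cdf /distribution /pushforward; congr (P _).
    by apply/seteqP; split => w /=; rewrite in_itv/= lerBlDr.
  exact: hitting_time_cvg.
- by move=> c q q01; exact: dTV_diam_cvg.
- exact: prob_diam_above.
- exact: prob_diam_below.
Qed.
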